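(* Let $u\in C^R_b(\mathbb R,\mathbb R^d)$ be a solution of $$-\partial_x\nabla_vE(u,u')+\nabla_uE(u,u')+DS(u)^T\,K*S(u)=0.$$ Then for any $v\in T_uC^1_b(\mathbb R,\mathbb R^d)=C^1_b(\mathbb R,\mathbb R^d)$, $$-D\mathcal H(u)v=\omega_u(u',v).$$
   Context: $\mathcal M(\mathbb R^d)$ denotes real $d\times d$ matrices. The kernel $K:\mathbb R\to\mathcal M(\mathbb R^d)$ satisfies $K(r)=K(-r)$, $K(r)=K(r)^T$, $K\in L^1(\mathbb R,\mathcal M(\mathbb R^d))$, and $\int_{\mathbb R}(1+|r|)\|K(r)\|\,dr<\infty$. $S\in C^2(\mathbb R^d,\mathbb R^d)$, $E=E(u,v)\in C^2(\mathbb R^d\times\mathbb R^d,\mathbb R)$, and $K*S(u)(x)=\int_{\mathbb R}K(x-y)S(u(y))\,dy$. Set $R=1$ if $\nabla_vE\equiv0$ and $R=2$ otherwise. $C^k_b(\mathbb R,\mathbb R^d)$ is the space of $C^k$ functions which are uniformly bounded together with their first $k$ derivatives. Let $Q:=(-\infty,0)\times(0,\infty)$. The function $\mathcal H$ on $C^1_b(\mathbb R,\mathbb R^d)$ is $$\mathcal H(u):=-\Big(E(u,u')-\nabla_vE(u,u')\cdot u'+\tfrac12S(u)\cdot K*S(u)\Big)\Big|_{x=0}+\tfrac12\iint_Q\Big(S(u(x))\cdot K(x-y)DS(u(y))u'(y)-S(u(y))\cdot K(x-y)DS(u(x))u'(x)\Big)dx\,dy.$$ The exact presymplectic form is $\omega=d\lambda=\omega^n+\omega^{\mathrm{loc}}$,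 where $\lambda=\lambda^n+\lambda^{\mathrm{loc}}$ is the 1-form on $C^1_b(\mathbb R,\mathbb R^d)$ given by $$\lambda^n_u(v)=\iint_Qv(x)\cdot DS(u(x))^TK(x-y)S(u(y))\,dx\,dy,\qquad \lambda^{\mathrm{loc}}_u(v)=-\big(\nabla_vE(u,u')\cdot v\big)\big|_{x=0},$$ with the exterior derivative $d\lambda_u(v,w)=D_u[\lambda_u(v)](w)-D_u[\lambda_u(w)](v)$. Explicitly, $$\omega^n_u(v,w)=\iint_Q\Big(v(x)\cdot A_{xy}(u)w(y)-v(y)\cdot A_{yx}(u)w(x)\Big)dx\,dy,\qquad A_{xy}(u)=DS(u(x))^TK(x-y)DS(u(y)),$$ $$\omega^{\mathrm{loc}}_u(v,w)=\Big(w\cdot\nabla_v^2E(u,u')v'-v\cdot\nabla_v^2E(u,u')w'+w\cdot\nabla_u\nabla_vE(u,u')v-v\cdot\nabla_u\nabla_vE(u,u')w\Big)\Big|_{x=0},$$ where $\nabla_u\nabla_vE\,w$ denotes the derivative of $\nabla_vE$ with respect to $u$ in direction $w$. If $R=1$ then $\omega^{\mathrm{loc}}=0$, and $\omega_u(u',v)$ with $u'\in C^0_b$ is understood through the explicit formula for $\omega^n$. *)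

(* Defs.v *)
From HB Require Import structures.
From mathcomp Require Import all_boot all_order all_algebra.
From mathcomp Require Import all_classical all_reals all_analysis.

Set Implicit Arguments.
Unset Strict Implicit.
Unset Printing Implicit Defensive.
Import Order.TTheory GRing.Theory Num.Theory.
Import numFieldNormedType.Exports.
Local Open Scope classical_set_scope.
Local Open Scope ring_scope.

(* In finite dimension this is the usual C^k: continuity of x |-> 'D_v f x for
   every v is continuity of x |-> 'd f x in operator norm. *)
Fixpoint Ck (R : realType) (V W : normedModType R) (k : nat) (f : V -> W) :
    Prop :=
  match k with
  | 0 => continuous f
  | k'.+1 => (forall x, differentiable f x) /\
             (forall v : V, Ck k' (fun x => 'D_v f x))
  end.

Definition Ckb (R : realType) (V : normedModType R) (k : nat) (u : R -> V) :
    Prop :=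
  [/\ forall j, (j < k)%N -> forall x, derivable (derive1n j u) x 1,
      continuous (derive1n k u) &
      forall j, (j <= k)%N -> exists M : R, forall x, `|(derive1n j u) x| <= M].

Section Ckb_submod.
Context {R : realType} {V : normedModType R} (k : nat).
Implicit Types u v : R -> V.

Lemma derive1nP (a : R) u v j : Ckb k u -> Ckb k v -> (j <= k)%N ->
  derive1n j (a *: u + v) = a *: (derive1n j u) + (derive1n j v).
Proof.
move=> [du _ _] [dv _ _]; elim: j => [|j IH] jk; first by rewrite !derive1n0.
rewrite !derive1nS IH ?(ltnW jk)//; apply/funext => x.
rewrite !derive1E deriveD; [|by apply: derivableZ; exact: du|exact: dv].
rewrite deriveZ; last exact: du.
by rewrite /GRing.add/= /GRing.scale/= !derive1E.
Qed.

Lemma derive1n_0 j : derive1n j (0 : R -> V) = 0.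
Proof.
elim: j => [|j IH]; first by rewrite derive1n0.
by rewrite derive1nS IH; apply/funext => x; rewrite derive1E derive_cst.
Qed.

Definition Ckb_pred : {pred R -> V} := fun u => `[< Ckb k u >].

Lemma Ckb_submod_closed : submod_closed Ckb_pred.
Proof.
split=> [|a u v /asboolP Cu /asboolP Cv]; apply/asboolP.
  split=> [j _ x||j _]; rewrite derive1n_0; first exact: derivable_cst.
    by move=> x; exact: cst_continuous.
  by exists 0 => x; rewrite normr0.
have E := derive1nP a Cu Cv; case: (Cu) (Cv) => [du cu bu] [dv cv bv].
split=> [j jk x||j jk].
- rewrite E ?(ltnW jk)//; apply: derivableD; last exact: dv.
  by apply: derivableZ; exact: du.
- rewrite E// => x; apply: continuousD; last exact: cv.
  by apply: cvgZl_tmp; exact: cu.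
- have [M uM] := bu j jk; have [N vN] := bv j jk.
  exists (`|a| * M + N) => x; rewrite E// (le_trans (ler_normD _ _))//.
  by rewrite lerD ?vN// normrZ ler_wpM2l.
Qed.

HB.instance Definition _ :=
  GRing.isSubmodClosed.Build R (R -> V) Ckb_pred Ckb_submod_closed.

End Ckb_submod.

Section C1b.
Context (R : realType) (d : nat).

Record C1b := MkC1b {
  c1b_fun :> R -> 'cV[R]_d ;
  c1b_prop : c1b_fun \in @Ckb_pred R 'cV[R]_d 1 }.

HB.instance Definition _ := [isSub for c1b_fun].
HB.instance Definition _ := gen_eqMixin C1b.
HB.instance Definition _ := gen_choiceMixin C1b.
HB.instance Definition _ := [SubChoice_isSubLmodule of C1b by <:].

Definition sup_norm (u : R -> 'cV[R]_d) : R := sup (range (fun x => `|u x|)).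

Definition C1b_norm (u : C1b) : R := sup_norm u + sup_norm (derive1 u).

Let sup_normP (u : R -> 'cV[R]_d) x :
  (exists M : R, forall x, `|u x| <= M) -> `|u x| <= sup_norm u.
Proof.
move=> [M uM]; apply: ub_le_sup; last by exists x.
by exists M => _ [y _ <-].
Qed.

Let sup_norm_le (u : R -> 'cV[R]_d) M : (forall x, `|u x| <= M) ->
  sup_norm u <= M.
Proof.
by move=> uM; apply: ge_sup; [exists `|u 0|, 0|move=> _ [y _ <-]].
Qed.

Let C1bP (u : C1b) : Ckb 1 (u : R -> 'cV[R]_d).
Proof. exact/asboolP/c1b_prop. Qed.

Let C1b_bnd (u : C1b) : exists M : R, forall x, `|u x| <= M.
Proof. by have [_ _ /(_ 0%N)] := C1bP u; rewrite derive1n0; apply. Qed.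

Let C1b_bnd1 (u : C1b) : exists M : R, forall x, `|(derive1 u) x| <= M.
Proof. by have [_ _ /(_ 1%N)] := C1bP u; rewrite derive1n1; apply. Qed.

Let C1b_derP (a : R) (u v : C1b) :
  derive1 ((a *: u + v : C1b) : R -> 'cV[R]_d) = a *: (derive1 u) + (derive1 v).
Proof. by have := derive1nP a (C1bP u) (C1bP v) (leqnn 1); rewrite !derive1n1. Qed.

Lemma C1b_normD (u v : C1b) : C1b_norm (u + v) <= C1b_norm u + C1b_norm v.
Proof.
rewrite /C1b_norm addrACA lerD//; apply: sup_norm_le => x.
  by rewrite (le_trans (ler_normD _ _))// lerD// sup_normP.
have -> : derive1 (u + v : C1b) = (derive1 u) + (derive1 v).
  by have := C1b_derP 1 u v; rewrite !scale1r.
by rewrite (le_trans (ler_normD _ _))// lerD// sup_normP.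
Qed.

Let sup_normZ (a : R) (u : R -> 'cV[R]_d) :
  (exists M : R, forall x, `|u x| <= M) -> sup_norm (a *: u) = `|a| * sup_norm u.
Proof.
move=> bu; have le b w : (exists M : R, forall x, `|w x| <= M) ->
    sup_norm (b *: w) <= `|b| * sup_norm w.
  move=> bw; apply: sup_norm_le => x.
  by rewrite normrZ ler_wpM2l// sup_normP.
apply/eqP; rewrite eq_le le//=.
have [->|a0] := eqVneq a 0.
  rewrite normr0 mul0r; apply: le_trans (sup_normP 0 _); first exact: normr_ge0.
  by exists 0 => x; rewrite normrZ normr0 mul0r.
rewrite mulrC -ler_pdivlMr ?normr_gt0// mulrC -normfV.
rewrite -{1}[u]scale1r -(mulVf a0) -scalerA le//.
have [M uM] := bu; exists (`|a| * M) => x.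
by rewrite normrZ ler_wpM2l.
Qed.

Lemma C1b_normZ (a : R) (u : C1b) : C1b_norm (a *: u) = `|a| * C1b_norm u.
Proof.
rewrite /C1b_norm mulrDr -!sup_normZ//; congr (_ + sup_norm _).
have := C1b_derP a u 0; rewrite addr0 => ->.
by have /= -> := @derive1n_0 R 'cV[R]_d 1; rewrite addr0.
Qed.

Lemma C1b_norm0_eq0 (u : C1b) : C1b_norm u = 0 -> u = 0.
Proof.
move=> u0; apply/val_inj/funext => x /=; apply/eqP; rewrite -normr_le0.
rewrite -u0 /C1b_norm (le_trans (sup_normP x (C1b_bnd u)))// lerDl.
exact: le_trans (sup_normP 0 (C1b_bnd1 u)).
Qed.

HB.instance Definition _ :=
  Lmodule_isNormed.Build R C1b C1b_normD C1b_normZ C1b_norm0_eq0.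

End C1b.

Section Setting.
Context {R : realType} {d : nat}.
Notation vec := 'cV[R]_d.
Notation mat := 'M[R]_d.
Notation mu := (@lebesgue_measure R).

Definition dotv (a b : vec) : R := \sum_(i < d) a i 0 * b i 0.

Definition Jac (F : vec -> vec) (p : vec) : mat :=
  \matrix_(i, j) ('d F p (delta_mx j 0 : vec)) i 0.

Definition grad (f : vec -> R) (p : vec) : vec :=
  \col_i 'd f p (delta_mx i 0 : vec).

Definition grad_u (E : vec * vec -> R) (p : vec * vec) : vec :=
  grad (fun a => E (a, p.2)) p.1.
Definition grad_v (E : vec * vec -> R) (p : vec * vec) : vec :=
  grad (fun b => E (p.1, b)) p.2.

Definition jet (u : R -> vec) (x : R) : vec * vec := (u x, (derive1 u) x).

(* Order of the Euler-Lagrange equation in u, i.e. the number of derivatives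
   required of a solution; written R in the mathematical text. *)
Definition regularity (E : vec * vec -> R) : nat :=
  if `[< forall p, grad_v E p = 0 >] then 1%N else 2%N.

Definition kernel_L1 (K : R -> mat) : Prop :=
  forall i j, mu.-integrable setT (EFin \o (fun r => K r i j)).

Definition kernel_moment (K : R -> mat) : Prop :=
  (\int[mu]_r ((1 + `|r|) * `|K r|)%:E < +oo)%E.

Definition convK (K : R -> mat) (S : vec -> vec) (u : R -> vec) (x : R) : vec :=
  \col_i \int[mu]_y (K (x - y) *m S (u y)) i 0.

Definition solution (K : R -> mat) (S : vec -> vec) (E : vec * vec -> R)
    (u : R -> vec) : Prop :=
  forall x, - derive1 (fun z => grad_v E (jet u z)) x + grad_u E (jet u x)
            + (Jac S (u x))^T *m convK K S u x = 0.

Definition intQ (g : R -> R -> R) : R :=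
  \int[(mu \x mu)%E]_(p in `]-oo, 0[ `*` `]0, +oo[) g p.1 p.2.

Definition Ham (K : R -> mat) (S : vec -> vec) (E : vec * vec -> R)
    (u : R -> vec) : R :=
  - (E (jet u 0) - dotv (grad_v E (jet u 0)) ((derive1 u) 0)
     + 2^-1 * dotv (S (u 0)) (convK K S u 0))
  + 2^-1 * intQ (fun x y =>
      dotv (S (u x)) (K (x - y) *m (Jac S (u y) *m (derive1 u) y))
      - dotv (S (u y)) (K (x - y) *m (Jac S (u x) *m (derive1 u) x))).

Definition lambda_n (K : R -> mat) (S : vec -> vec) (u v : R -> vec) : R :=
  intQ (fun x y =>
    dotv (v x) ((Jac S (u x))^T *m (K (x - y) *m S (u y)))).

Definition lambda_loc (E : vec * vec -> R) (u v : R -> vec) : R :=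
  - dotv (grad_v E (jet u 0)) (v 0).

Definition lambda (K : R -> mat) (S : vec -> vec) (E : vec * vec -> R)
    (u v : R -> vec) : R :=
  lambda_n K S u v + lambda_loc E u v.

(* D_u[lambda_u(v)](w), the derivative of u |-> lambda_u(v) in direction w. *)
Definition Dlambda (K : R -> mat) (S : vec -> vec) (E : vec * vec -> R)
    (u v w : R -> vec) : R :=
  derive1 (fun t : R => lambda K S E (u + t *: w) v) 0.

Definition dlambda (K : R -> mat) (S : vec -> vec) (E : vec * vec -> R)
    (u v w : R -> vec) : R :=
  Dlambda K S E u v w - Dlambda K S E u w v.

Definition Axy (K : R -> mat) (S : vec -> vec) (u : R -> vec) (x y : R) : mat :=
  (Jac S (u x))^T *m K (x - y) *m Jac S (u y).

Definition omega_n (K : R -> mat) (S : vec -> vec) (u v w : R -> vec) : R :=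
  intQ (fun x y => dotv (v x) (Axy K S u x y *m w y)
                   - dotv (v y) (Axy K S u y x *m w x)).

(* omega = d lambda on C^1_b.  If grad_v E = 0, the first argument is allowed to
   be u' with u only in C^1_b, hence merely in C^0_b; omega is then given by the
   integral formula for omega^n, and omega^loc = 0. *)
Definition omega (K : R -> mat) (S : vec -> vec) (E : vec * vec -> R)
    (u v w : R -> vec) : R :=
  if regularity E == 1%N then omega_n K S u v w else dlambda K S E u v w.

End Setting.

(* Main.v *)
From HB Require Import structures.
Require Import Defs.
From mathcomp Require Import all_boot all_order all_algebra.
From mathcomp Require Import all_classical all_reals all_analysis.
From mathcomp Require Import measurable_realfun ring lra.
Import Order.TTheory GRing.Theory Num.Theory.
Import numFieldNormedType.Exports.
Local Open Scope classical_set_scope.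
Local Open Scope ring_scope.
Set Implicit Arguments.
Unset Strict Implicit.
Unset Printing Implicit Defensive.

(** Write s = S o u, s' for its derivative, sigma = DS(u) v, and let P(f, g) be
    the integral of f(x) . K(x-y) g(y) over the quadrant x < 0 < y and
    c(f, g) = f(0) . (K * g)(0).  The Hamiltonian splits into a local energy at
    x = 0 and the quadratic functional
    N(u) = - c(s, s) / 2 + (P(s, s') - P(s', s)) / 2, while
    omega^n_u(v, w) = P(DS(u) v, DS(u) w) - P(DS(u) w, DS(u) v).

    The heart of the matter is an integration by parts
    (quadrant_form_antisym): in the coordinates x and r = y - x the kernel does
    not depend on x, so P(f, g') + P(f', g) reduces to boundary terms at x = 0,
    and after antisymmetrisation these are the convolutions
    c(f, g) - c(g, f).  The moment condition on K makes P a bilinear form that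
    is bounded in the supremum norm of bounded continuous functions
    (quadrant_form_bilinear).

    Expanding N at u, with Delta the increment of s, the same identity removes
    the derivative of Delta from the terms of first order
    (antisym_increment).  What remains is
    - c(Delta, s) + P(Delta, s') - P(s', Delta), which is bounded in the
    supremum norm of Delta, plus a quadratic remainder.  Hence N is Frechet
    differentiable on C^1_b as soon as Delta = sigma + o(|h|) uniformly and the
    derivative of Delta is uniformly small (increment_bounds, nonlocal_diff).
    These estimates hold because the values of u stay in a ball, on which C^1
    functions are uniformly differentiable (strict_diff, uniform_on_balls).

    The derivative of N in the direction v is therefore
    - c(sigma, s) - omega^n_u(u', v).  The local energy contributes
    grad_u E . v and the derivatives of the momenta (diff_local_energy); the
    Euler-Lagrange equation at x = 0 replaces grad_u E . v by the x-derivative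
    of the momenta minus c(sigma, s), which cancels the convolution.  If
    grad_v E = 0 only omega^n is left.  Otherwise d lambda is computed by
    differentiating under the double integral (bilin_is_derive, DlambdaE); the
    terms with the second derivative of S are symmetric by Schwarz's theorem
    (derive_schwarz) and cancel in the antisymmetrisation, and the rest is
    exactly omega^n plus the derivatives of the momenta. *)

(** * Measure-preserving changes of variables *)

Section measure_preserving.
Local Open Scope ereal_scope.
Context {dT : measure_display} {T : measurableType dT} {R : realType}.
Variables (m : {measure set T -> \bar R}) (phi : T -> T).
Hypothesis mphi : measurable_fun [set: T] phi.
Hypothesis phi_m : forall A, measurable A -> m (phi @^-1` A) = m A.
Variables (D : set T) (f : T -> \bar R).
Hypotheses (mD : measurable D) (mf : measurable_fun [set: T] f).
Hypothesis fI : m.-integrable (phi @^-1` D) (f \o phi).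

Lemma measure_preserving_integrable : m.-integrable D f.
Proof.
have /integrableP[_ H] := integrable_pushforward mphi mf fI mD.
apply/integrableP; split; first exact: measurable_funTS.
apply: le_lt_trans H; rewrite le_eqVlt; apply/orP; left; apply/eqP.
by apply: eq_measure_integral => // A mA _; apply/esym/phi_m.
Qed.

Lemma measure_preserving_integral :
  \int[m]_(x in D) f x = \int[m]_(x in phi @^-1` D) f (phi x).
Proof.
rewrite -(integral_pushforward mphi mf fI mD).
by apply: eq_measure_integral => // A mA _; apply/esym/phi_m.
Qed.

End measure_preserving.

Section shear.
Context {R : realType}.
Notation mu := (@lebesgue_measure R).

Lemma lebesgue_measure_shift (a : R) (A : set (measurableTypeR R)) : measurable A ->
  mu ((fun x : measurableTypeR R => a + x) @^-1` A) = mu A.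
Proof.
move=> mA; apply/esym.
have mf : measurable_fun setT (fun x : measurableTypeR R => a + x : measurableTypeR R).
  exact: measurable_funD.
apply: (lebesgue_measure_unique (mu := pushforward mu _)) => // _ [[x y] _ <-] /=.
rewrite /pushforward /=.
rewrite (_ : _ @^-1` _ = `]x - a, y - a]%classic); last first.
  by apply/seteqP; split => z /=; rewrite !in_itv/= ltrBlDl lerBrDl.
rewrite !lebesgue_measure_itv/= !lte_fin ltrD2r; case: ifP => // _.
by rewrite -!EFinD opprB addrA subrK.
Qed.

(** In the coordinates (x, r) with y = x + r the kernel K(x - y) depends on r
    alone. *)
Definition shear (p : R * R) : R * R := (p.1, p.1 + p.2).

Lemma measurable_shear :
  measurable_fun setT (shear : measurableTypeR R * measurableTypeR R -> measurableTypeR R * measurableTypeR R).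
Proof.
apply/measurable_fun_pairP; split => /=.
  exact: measurable_fst.
apply: measurable_funD; [exact: measurable_fst|exact: measurable_snd].
Qed.

(** On each vertical line the shear is a translation. *)
Lemma product_measure_shear (A : set (measurableTypeR R * measurableTypeR R)) : measurable A ->
  (mu \x mu)%E (shear @^-1` A) = (mu \x mu)%E A.
Proof.
move=> mA; rewrite /product_measure1 /=.
apply: eq_integral => x _ /=.
rewrite -[RHS](@lebesgue_measure_shift x); last exact: measurable_xsection.
congr (mu _); apply/seteqP; split => y /=; by rewrite /xsection /= !inE.
Qed.
End shear.

(** * Kernels on the quadrant in sheared coordinates *)

Section strip.
Context {R : realType}.
Notation mu := (@lebesgue_measure R).
Notation mR := (measurableTypeR R).

Definition quadrant : set (R * R) := `]-oo, 0[ `*` `]0, +oo[.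

Lemma measurable_quadrant : measurable (quadrant : set (mR * mR)).
Proof. exact: measurableX. Qed.

Variable k : R -> R.
Hypothesis kI : mu.-integrable setT (EFin \o k).
Hypothesis kmom : (\int[mu]_r (`|r| * `|k r|)%:E < +oo)%E.
Hypothesis keven : forall r, k (- r) = k r.

Let mk : measurable_fun setT (k : mR -> mR).
Proof. by have /integrableP[/measurable_EFinP] := kI. Qed.

(** For fixed r the slice of the sheared quadrant is the interval ]-r, 0[, of
    length r: this is where the weight |r| in the moment condition comes
    from. *)
Let strip : set (mR * mR) := shear @^-1` quadrant.

Let mstrip : measurable strip.
Proof.
by rewrite -[strip]setTI; apply: measurable_shear => //; exact: measurable_quadrant.
Qed.

Section weight.
Variable F : mR * mR -> mR.
Hypothesis mF : measurable_fun setT F.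
Variable M : R.
Hypothesis FM : forall p, `|F p| <= M.

Let G (p : mR * mR) : R := k (p.1 - p.2) * F p.

Let mG : measurable_fun setT G.
Proof.
apply: measurable_funM => //; apply: measurableT_comp => //.
by apply: measurable_funB; [exact: measurable_fst|exact: measurable_snd].
Qed.

Let mGs : measurable_fun setT (G \o shear).
Proof. by apply: measurableT_comp => //; exact: measurable_shear. Qed.

Let G_shear x r : G (shear (x, r)) = k r * F (x, x + r).
Proof. by rewrite /G /shear /= opprD addrA subrr add0r keven. Qed.

Let stripE x r : ((x, r) \in strip) = (x \in (`]- r, 0[%classic : set R)).
Proof.
apply/idP/idP; rewrite !inE /strip /quadrant /shear /= !in_itv/= ?andbT.
  by move=> [-> xr]; rewrite andbT -subr_gt0 opprK.
by rewrite ltrNl -subr_gt0 opprK addrC => /andP[rx ->]; split => //; rewrite addrC.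
Qed.

Lemma restrict_strip r (g : mR * mR -> \bar R) :
  (fun x : mR => (g \_ strip) (x, r)) = (fun x => g (x, r)) \_ `]- r, 0[.
Proof. by apply/funext => x; rewrite !patchE stripE. Qed.

Lemma integrable_strip : (mu \x mu)%E.-integrable strip (EFin \o G \o shear).
Proof.
have M0 : 0 <= M by rewrite (le_trans _ (FM (0, 0))).
apply/integrable_mkcond => //; apply/integrable21ltyP.
  by apply/(measurable_restrictT _ _).1 => //; apply/measurable_EFinP/measurable_funTS.
apply: (@le_lt_trans _ _ (M%:E * \int[mu]_r (`|r| * `|k r|)%:E)%E); last first.
  by rewrite lte_mul_pinfty.
have mrk : measurable_fun setT (fun r : mR => (`|r| * `|k r|)%:E).
  apply/measurable_EFinP; by apply: measurable_funM => //; apply: measurableT_comp.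
rewrite -ge0_integralZl//.
have mG1 : measurable_fun setT (((fun p => `|(G \o shear) p|%:E) \_ strip)).
  apply/(measurable_restrictT _ _).1 => //; apply/measurable_EFinP.
  by apply: measurable_funTS; apply: measurableT_comp.
(* the restriction to the strip is moved outside the absolute value, so that
   each horizontal slice becomes an integral over ]-r, 0[ *)
have E : (fun r => \int[mu]_x `|((EFin \o G \o shear) \_ strip) (x, r)|)%E
   = (fun r => \int[mu]_x (((fun p => `|(G \o shear) p|%:E) \_ strip) (x, r)))%E.
  apply/funext => r; apply: eq_integral => x _.
  by rewrite !patchE; case: ifP => //=; rewrite normr0.
rewrite E.
apply: ge0_le_integral => //.
- by move=> r _; apply: integral_ge0 => x _; rewrite patchE; case: ifP => //= _; rewrite lee_fin.
- apply: (@measurable_fun_fubini_tonelli_G _ _ _ _ _ mu _ mG1).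
  by move=> x; rewrite patchE; case: ifP => //= _; rewrite lee_fin.
- by apply/measurable_EFinP; apply: measurable_funM => //; apply/measurable_EFinP.
move=> r _; rewrite restrict_strip -integral_mkcond.
have mK : measurable_fun `]- r, 0[%classic (fun x : mR => `|(G \o shear) (x, r)|%:E).
  apply/measurable_EFinP; apply: measurable_funTS; apply: measurableT_comp => //.
  exact: measurable_fun_pair1.
apply: le_trans.
  apply: (@ge0_le_integral _ _ _ _ _ _ _ (fun=> (M * `|k r|)%:E)) => //.
  by move=> x _; rewrite /= G_shear lee_fin normrM mulrC ler_wpM2r.
rewrite integral_cst//= lebesgue_measure_itv/= lte_fin oppr_lt0.
case: ifPn => [r0|_]; last by rewrite mule0 mule_ge0 ?lee_fin ?mulr_ge0.
rewrite -EFinD -!EFinM lee_fin sub0r opprK -mulrA ler_wpM2l//.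
by rewrite mulrC ler_wpM2r// ler_norm.
Qed.

Lemma integrable_quadrant : (mu \x mu)%E.-integrable quadrant (EFin \o G).
Proof.
have mE : measurable_fun setT (EFin \o G) by exact/measurable_EFinP.
exact: (measure_preserving_integrable measurable_shear product_measure_shear
  measurable_quadrant mE integrable_strip).
Qed.

(** Integrating first over x at fixed r = y - x turns an exact derivative in x
    into boundary terms at x = 0 and x = -r. *)
Lemma Rintegral_quadrant_strip :
  \int[(mu \x mu)%E]_(p in quadrant) G p =
  \int[mu]_(r in `]0, +oo[) (k r * \int[mu]_(x in `]- r, 0[) F (x, x + r)).
Proof.
have mE : measurable_fun setT (EFin \o G) by exact/measurable_EFinP.
rewrite /Rintegral; congr fine.
rewrite (measure_preserving_integral measurable_shear product_measure_shear
  measurable_quadrant mE integrable_strip).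
rewrite [LHS]integral_mkcond -integral21_prod_meas1; last first.
  exact: (integrable_mkcond _ mstrip).1 integrable_strip.
rewrite [RHS]integral_mkcond; apply: eq_integral => r _.
rewrite [in LHS]/fubini_G restrict_strip -integral_mkcond patchE; case: ifPn => [r0|r0]; last first.
  rewrite set_itv_ge ?integral_set0// bnd_simp -leNgt.
  by rewrite lerNr oppr0 leNgt; apply: contra r0 => r0; rewrite inE/= in_itv/= r0.
under eq_integral do rewrite /= G_shear.
have FI : mu.-integrable `]- r, 0[%classic (fun x => (F (x, x + r))%:E).
  apply: measurable_bounded_integrable => //.
  - by rewrite /= lebesgue_measure_itv/=; case: ifP => _; rewrite ltry.
  - apply: measurable_funTS; apply: (measurableT_comp mF).
    by apply: measurable_fun_pair => //; apply: measurable_funD.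
  - exists M; split; rewrite ?num_real// => N MN x _.
    by rewrite /= (le_trans (FM _))// ltW.
by rewrite EFinM fineK ?integrable_fin_num// -integralZl.
Qed.
End weight.
End strip.

(** * Integrals over intervals and half-lines *)

Section scalar_ibp.
Context {R : realType}.
Notation mu := (@lebesgue_measure R).
Notation mR := (measurableTypeR R).

Lemma Rintegral_FTC_oo (f F : R -> R) (a b : R) : a < b -> continuous f ->
  (forall x : R, is_derive x (1 : R) F (f x)) ->
  \int[mu]_(x in `]a, b[) f x = F b - F a.
Proof.
move=> ab cf dF.
have fI : mu.-integrable `[a, b]%classic (EFin \o f).
  apply: continuous_compact_integrable; first exact: segment_compact.
  exact: continuous_subspaceT.
have cF : continuous F.
  by move=> x; apply/differentiable_continuous/derivable1_diffP; have [] := dF x.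
have sI : mu.-integrable `]a, b]%classic (EFin \o f).
  by apply: integrableS fI => //; apply: subset_itvr; rewrite bnd_simp.
rewrite Rintegral_itv_bndo_bndc; last first.
  by apply: integrableS sI => //; apply: subset_itvl; rewrite bnd_simp.
rewrite Rintegral_itv_obnd_cbnd// /Rintegral (continuous_FTC2 ab (F := F))//.
- exact: continuous_subspaceT.
- split.
  + by move=> x _; have [] := dF x.
  + exact/cvg_at_right_filter/cF.
  + exact/cvg_at_left_filter/cF.
- by move=> x _; rewrite derive1E; have [_ ->] := dF x.
Qed.

Lemma Rintegral_split0 (f : R -> R) : mu.-integrable setT (EFin \o f) ->
  \int[mu]_x f x = \int[mu]_(r in `]0, +oo[) (f r + f (- r)).
Proof.
move=> fI.
have fS (D : set R) : measurable (D : set mR) -> mu.-integrable D (EFin \o f).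
  by move=> mD; apply: integrableS fI.
have mf : measurable_fun setT (EFin \o f : mR -> _) by have /integrableP[] := fI.
have mN : measurable_fun setT (-%R : mR -> mR) by exact: oppr_measurable.
have NE : (-%R : mR -> mR) @^-1` `]0, +oo[ = `]-oo, 0[%classic.
  by apply/seteqP; split => x /=; rewrite !in_itv/= andbT oppr_gt0.
have NE' : (-%R : mR -> mR) @^-1` `]-oo, 0[ = `]0, +oo[%classic.
  by apply/seteqP; split => x /=; rewrite !in_itv/= andbT oppr_lt0.
have mfN : measurable_fun setT ((EFin \o (fun r => f (- r))) : mR -> _).
  exact: (measurableT_comp mf).
have NI : mu.-integrable ((-%R : mR -> mR) @^-1` `]0, +oo[)
    ((EFin \o (fun r => f (- r))) \o (-%R : mR -> mR)).
  by rewrite NE; apply: eq_integrable (fS _ _) => // x _ /=; rewrite opprK.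
have mO : measurable (`]0%R, +oo[%classic : set mR) by [].
have fNI := measure_preserving_integrable mN (@lebesgue_measureN R) mO mfN NI.
rewrite RintegralD//=; last by apply: fS.
have -> : \int[mu]_(r in `]0, +oo[) f (- r) = \int[mu]_(r in `]-oo, 0[) f r.
  rewrite /Rintegral.
  rewrite (measure_preserving_integral mN (@lebesgue_measureN R) mO mfN NI) NE.
  by congr fine; apply: eq_integral => x _ /=; rewrite opprK.
have := @Rintegral_itvB _ f -oo%O +oo%O 0.
rewrite set_itvE => /(_ fI) => <- //; rewrite Rintegral_itv_bndo_bndc ?subrK//.
exact: fS.
Qed.
End scalar_ibp.

(** * Integration by parts against a scalar kernel *)

Section scalar_form.
Context {R : realType}.
Notation mu := (@lebesgue_measure R).
Notation mR := (measurableTypeR R).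

Variable k : R -> R.
Hypothesis kI : mu.-integrable setT (EFin \o k).
Hypothesis kmom : (\int[mu]_r (`|r| * `|k r|)%:E < +oo)%E.
Hypothesis keven : forall r, k (- r) = k r.

(** The moment condition makes f(x) k(x-y) g(y) integrable over the quadrant for
    all such f and g, without any decay: they are the arguments of every
    bilinear form below. *)
Definition cbnd {V : normedModType R} (f : R -> V) : Prop :=
  continuous f /\ exists M, forall x, `|f x| <= M.

Definition kernel_form (f g : R -> R) : R := intQ (fun x y => k (x - y) * (f x * g y)).

Lemma cbnd_measurable (f : R -> R) : cbnd f -> measurable_fun setT (f : mR -> mR).
Proof. by move=> [cf _]; apply: continuous_measurable_fun. Qed.

Lemma measurable_tensor (f g : R -> R) : cbnd f -> cbnd g ->
  measurable_fun setT ((fun p => f p.1 * g p.2) : mR * mR -> mR).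
Proof.
move=> /cbnd_measurable mf /cbnd_measurable mg; apply: measurable_funM.
  exact: measurableT_comp mf measurable_fst.
exact: measurableT_comp mg measurable_snd.
Qed.

Lemma tensor_bounded (f g : R -> R) M N :
  (forall x, `|f x| <= M) -> (forall x, `|g x| <= N) ->
  forall p : mR * mR, `|f p.1 * g p.2| <= M * N.
Proof. by move=> fM gN p; rewrite normrM ler_pM. Qed.

Lemma kernel_form_integrable (f g : R -> R) : cbnd f -> cbnd g ->
  (mu \x mu)%E.-integrable (`]-oo, 0[ `*` `]0, +oo[)
    (fun p => (k (p.1 - p.2) * (f p.1 * g p.2))%:E).
Proof.
move=> fc gc; have [[_ [M fM]] [_ [N gN]]] := (fc, gc).
exact: (integrable_quadrant kI kmom keven (measurable_tensor fc gc)
  (tensor_bounded fM gN)).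
Qed.

Lemma conv_integrable (f : R -> R) : cbnd f ->
  mu.-integrable setT (fun r => (k r * f r)%:E).
Proof.
move=> fc; have [_ [M fM]] := fc.
apply: (le_integrable _ _ _ (integrableZl _ M kI)) => //.
  apply/measurable_EFinP; apply: measurable_funM; last exact: cbnd_measurable.
  by have /integrableP[/measurable_EFinP] := kI.
move=> x _; rewrite [leRHS]abseM !abse_EFin -EFinM lee_fin normrM mulrC ler_wpM2r//.
by rewrite (le_trans (fM x))// ler_norm.
Qed.

Lemma cbnd_lin (f g : R -> R) (a b : R) : cbnd f -> cbnd g ->
  cbnd (fun x => a * f x + b * g x).
Proof.
move=> [cf [M fM]] [cg [N gN]]; split.
  by move=> x; apply: cvgD; apply: cvgM; first [exact: cvg_cst|exact: cf|exact: cg].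
exists (`|a| * M + `|b| * N) => x.
by rewrite (le_trans (ler_normD _ _))// !normrM lerD// ler_wpM2l.
Qed.

Lemma cbnd_opp (f : R -> R) : cbnd f -> cbnd (fun x => f (- x)).
Proof.
move=> [cf [M fM]]; split; last by exists M.
by move=> x; apply: (@continuous_comp _ _ _ -%R f); [exact: opp_continuous|exact: cf].
Qed.

(** At fixed r > 0, f(x) g'(x+r) + f'(x) g(x+r) is the derivative of
    f(x) g(x+r) over ]-r, 0[. *)
Lemma kernel_form_ibp (f f' g g' : R -> R) :
  (forall x : R, is_derive x (1 : R) f (f' x)) ->
  (forall x : R, is_derive x (1 : R) g (g' x)) ->
  cbnd f -> cbnd f' -> cbnd g -> cbnd g' ->
  kernel_form f g' + kernel_form f' g =
  \int[mu]_(r in `]0, +oo[) (k r * (f 0 * g r - f (- r) * g 0)).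
Proof.
move=> df dg bf bf' bg bg'.
have [[cf [M fM]] [cg [N gN]]] := (bf, bg).
have [[cf' [M' fM']] [cg' [N' gN']]] := (bf', bg').
rewrite /kernel_form /intQ -RintegralD//; [|exact: measurable_quadrant|exact: kernel_form_integrable..].
pose F (p : mR * mR) := f p.1 * g' p.2 + f' p.1 * g p.2.
have mF : measurable_fun setT (F : _ -> mR).
  by apply: measurable_funD; exact: measurable_tensor.
have FM p : `|F p| <= M * N' + M' * N.
  by rewrite (le_trans (ler_normD _ _))// lerD// tensor_bounded.
transitivity (\int[(mu \x mu)%E]_(p in quadrant) (k (p.1 - p.2) * F p)).
  by apply: eq_Rintegral => p _; rewrite -mulrDr.
rewrite (Rintegral_quadrant_strip kI kmom keven mF FM); apply: eq_Rintegral => r.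
rewrite inE/= in_itv/= andbT => r0; congr (_ * _).
have dF x : is_derive (x : R) (1 : R) (fun x => f x * g (x + r)) (F (x, x + r)).
  have h1 := df x.
  have h2 : is_derive x (1 : R) (g \o shift r) (g' (x + r)).
    rewrite -[g' _]mulr1; apply: is_derive1_comp; exact: is_derive_shift.
  by apply: is_derive_eq; rewrite /F/= [f' x * _]mulrC.
rewrite (Rintegral_FTC_oo _ _ dF) ?oppr_lt0//.
- by rewrite add0r addNr.
- have cs : continuous (fun x : R => x + r).
    by move=> x; apply: cvgD; [exact: cvg_id|exact: cvg_cst].
  move=> x; rewrite /F/=; apply: cvgD; apply: cvgM; try exact: cf; try exact: cf'.
    by apply: (@continuous_comp _ _ _ (fun x => x + r)); [exact: cs|exact: cg'].
  by apply: (@continuous_comp _ _ _ (fun x => x + r)); [exact: cs|exact: cg].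
Qed.

(** After antisymmetrisation the two one-sided boundary terms of the
    integration by parts, at r and at -r, assemble into integrals of k over the
    whole line.  Hence the boundary value at the origin is a full convolution. *)
Lemma kernel_form_antisym (f f' g g' : R -> R) :
  (forall x : R, is_derive x (1 : R) f (f' x)) ->
  (forall x : R, is_derive x (1 : R) g (g' x)) ->
  cbnd f -> cbnd f' -> cbnd g -> cbnd g' ->
  kernel_form f g' + kernel_form f' g - kernel_form g f' - kernel_form g' f =
  f 0 * (\int[mu]_r (k r * g r)) - g 0 * \int[mu]_r (k r * f r).
Proof.
move=> df dg bf bf' bg bg'.
rewrite -addrA -opprD (kernel_form_ibp df dg)// (kernel_form_ibp dg df)//.
have mO : measurable (`]0%R, +oo[%classic : set mR) by [].
have I (a b : R) (p q : R -> R) : cbnd p -> cbnd q ->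
    mu.-integrable setT (EFin \o (fun r => k r * (a * p r + b * q r))).
  by move=> bp bq; apply: conv_integrable; exact: cbnd_lin.
have I' (a b : R) (p q : R -> R) : cbnd p -> cbnd q ->
    mu.-integrable `]0, +oo[%classic (EFin \o (fun r => k r * (a * p r - q r * b))).
  move=> bp bq; apply: (integrableS measurableT) => //.
  apply: eq_integrable (I a (- b) p q bp bq) => // x _ /=; congr (_ * _)%:E; ring.
rewrite -RintegralB//; try by apply: I' => //; exact: cbnd_opp.
rewrite -!RintegralZl//; try exact: conv_integrable.
have Z a (p : R -> R) : cbnd p ->
    mu.-integrable setT (EFin \o (fun r => a * (k r * p r))).
  by move=> bp; exact: (integrableZl _ a (conv_integrable bp)).
rewrite -RintegralB//; [|exact: Z..].
rewrite Rintegral_split0; last first.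
  apply: eq_integrable (I (f 0) (- g 0) g f bg bf) => // x _ /=; congr (_%:E); ring.
apply: eq_Rintegral => r _; rewrite keven; ring.
Qed.

End scalar_form.

Section scalar_bilinear.
Context {R : realType}.
Notation mu := (@lebesgue_measure R).
Notation mR := (measurableTypeR R).
Variable k : R -> R.
Hypothesis kI : mu.-integrable setT (EFin \o k).
Hypothesis kmom : (\int[mu]_r (`|r| * `|k r|)%:E < +oo)%E.
Hypothesis keven : forall r, k (- r) = k r.

Lemma kernel_form_linl (a : R) (f f' g : R -> R) : cbnd f -> cbnd f' -> cbnd g ->
  kernel_form k (fun x => a * f x + f' x) g = a * kernel_form k f g + kernel_form k f' g.
Proof.
move=> bf bf' bg; rewrite /kernel_form /intQ.
have mQ := @measurable_quadrant R.
have I1 := kernel_form_integrable kI kmom keven bf bg.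
have I2 := kernel_form_integrable kI kmom keven bf' bg.
rewrite -RintegralZl// -RintegralD//; last exact: (integrableZl mQ a I1).
by apply: eq_Rintegral => p _; ring.
Qed.

Lemma kernel_form_linr (a : R) (f g g' : R -> R) : cbnd f -> cbnd g -> cbnd g' ->
  kernel_form k f (fun x => a * g x + g' x) = a * kernel_form k f g + kernel_form k f g'.
Proof.
move=> bf bg bg'; rewrite /kernel_form /intQ.
have mQ := @measurable_quadrant R.
have I1 := kernel_form_integrable kI kmom keven bf bg.
have I2 := kernel_form_integrable kI kmom keven bf bg'.
rewrite -RintegralZl// -RintegralD//; last exact: (integrableZl mQ a I1).
by apply: eq_Rintegral => p _; ring.
Qed.

Lemma kernel_form_bound : exists2 C : R, 0 <= C & forall f g M N, cbnd f -> cbnd g ->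
  (forall x, `|f x| <= M) -> (forall x, `|g x| <= N) ->
  `|kernel_form k f g| <= C * (M * N).
Proof.
have mQ := @measurable_quadrant R.
have c1 : cbnd (fun _ : R => 1 : R).
  by split; [move=> x; exact: cvg_cst|exists 1 => x; rewrite normr1].
have I1 := integrable_norm (kernel_form_integrable kI kmom keven c1 c1).
exists (\int[(mu \x mu)%E]_(p in quadrant) `|k (p.1 - p.2) * (1 * 1)|).
  by apply: Rintegral_ge0.
move=> f g M N bf bg fM gN.
have I2 := kernel_form_integrable kI kmom keven bf bg.
rewrite (le_trans (le_normr_Rintegral mQ I2))//.
rewrite -RintegralZr//; apply: le_Rintegral => //.
- exact: integrable_norm I2.
- exact: (integrableZr mQ (M * N) I1).
move=> p _; rewrite mulr1 mulr1 normrM ler_wpM2l//.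
exact: (tensor_bounded fM gN p).
Qed.

Lemma conv_lin (a : R) (f f' : R -> R) : cbnd f -> cbnd f' ->
  \int[mu]_r (k r * (a * f r + f' r)) =
  a * (\int[mu]_r (k r * f r)) + \int[mu]_r (k r * f' r).
Proof.
move=> bf bf'; have I1 := conv_integrable kI bf; have I2 := conv_integrable kI bf'.
rewrite -RintegralZl// -RintegralD//; last exact: (integrableZl _ a I1).
by apply: eq_Rintegral => p _; ring.
Qed.

Lemma conv_bound : exists2 C : R, 0 <= C & forall f M, cbnd f ->
  (forall x, `|f x| <= M) -> `|\int[mu]_r (k r * f r)| <= C * M.
Proof.
have I1 := integrable_norm kI.
exists (\int[mu]_r `|k r|); first exact: Rintegral_ge0.
move=> f M bf fM; have I2 := conv_integrable kI bf.
rewrite (le_trans (le_normr_Rintegral _ I2))//.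
rewrite -RintegralZr//; apply: le_Rintegral => //.
- exact: integrable_norm I2.
- exact: (integrableZr _ M I1).
by move=> p _; rewrite normrM ler_wpM2l.
Qed.

End scalar_bilinear.

(** * Bounded bilinear forms of vector-valued functions *)

Section matrix_norm.
Context {R : realType}.

Lemma ler_coord m n (A : 'M[R]_(m, n)) i j : `|A i j| <= `|A|.
Proof. by rewrite [leRHS]/Num.norm/= mx_normrE; exact: (le_bigmax _ _ (i, j)). Qed.

Lemma mx_norm_le m n (A : 'M[R]_(m, n)) (e : R) : 0 <= e ->
  (forall i j, `|A i j| <= e) -> `|A| <= e.
Proof. by move=> e0 Ae; rewrite [leLHS]/Num.norm/= mx_normrE bigmax_le. Qed.

Lemma cV_norm_le d (a : 'cV[R]_d) (e : R) : 0 <= e ->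
  (forall i, `|a i 0| <= e) -> `|a| <= e.
Proof. by move=> e0 ae; apply: mx_norm_le => // i j; rewrite (ord1 j). Qed.

End matrix_norm.

Section bilinear.
Context {R : realType} {d : nat}.
Notation vec := 'cV[R]_d.
Notation mu := (@lebesgue_measure R).
Notation mR := (measurableTypeR R).

(** Linearity is restricted to bounded continuous functions because elsewhere
    the integrals that define the forms need not converge. *)
Record bounded_bilinear (B : (R -> vec) -> (R -> vec) -> R) : Prop := BoundedBilinear {
  bilinl : forall a f f' g, cbnd f -> cbnd f' -> cbnd g ->
    B (a *: f + f') g = a * B f g + B f' g ;
  bilinr : forall a f g g', cbnd f -> cbnd g -> cbnd g' ->
    B f (a *: g + g') = a * B f g + B f g' ;
  bilin_bound : exists2 C : R, 0 <= C & forall f g M N, cbnd f -> cbnd g ->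
    (forall x, `|f x| <= M) -> (forall x, `|g x| <= N) ->
    `|B f g| <= C * (M * N) }.

Lemma cbnd_coord (f : R -> vec) i : cbnd f -> cbnd (fun x => f x i 0 : R).
Proof.
move=> [cf [M fM]]; split; last first.
  by exists M => x; rewrite (le_trans (ler_coord _ _ _)).
by move=> x; apply: (@continuous_comp _ _ _ f (fun N : vec => N i 0)); [exact: cf|exact: coord_continuous].
Qed.

Lemma cbndD (f g : R -> vec) : cbnd f -> cbnd g -> cbnd (f + g).
Proof.
move=> [cf [M fM]] [cg [N gN]]; split.
  by move=> x; apply: cvgD; [exact: cf|exact: cg].
by exists (M + N) => x; rewrite (le_trans (ler_normD _ _))// lerD.
Qed.

Lemma cbndZ a (f : R -> vec) : cbnd f -> cbnd (a *: f).
Proof.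
move=> [cf [M fM]]; split; first by move=> x; apply: cvgZl_tmp; exact: cf.
by exists (`|a| * M) => x; rewrite normrZ ler_wpM2l.
Qed.

Lemma cbndN (f : R -> vec) : cbnd f -> cbnd (- f).
Proof. by rewrite -scaleN1r; exact: cbndZ. Qed.

Section double_sum.
Variable (b : 'I_d -> 'I_d -> (R -> R) -> (R -> R) -> R).
Hypothesis bl : forall i j (a : R) (f f' g : R -> R), cbnd f -> cbnd f' -> cbnd g ->
  b i j (fun x => a * f x + f' x) g = a * b i j f g + b i j f' g.
Hypothesis br : forall i j (a : R) (f g g' : R -> R), cbnd f -> cbnd g -> cbnd g' ->
  b i j f (fun x => a * g x + g' x) = a * b i j f g + b i j f g'.
Hypothesis bb : forall i j, exists2 C : R, 0 <= C & forall (f g : R -> R) M N,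
  cbnd f -> cbnd g -> (forall x, `|f x| <= M) -> (forall x, `|g x| <= N) ->
  `|b i j f g| <= C * (M * N).

Let B (f g : R -> vec) :=
  \sum_(i < d) \sum_(j < d) b i j (fun x => f x i 0) (fun x => g x j 0).

Lemma double_sum_bounded_bilinear : bounded_bilinear B.
Proof.
split.
- move=> a f f' g bf bf' bg; rewrite /B mulr_sumr -big_split/=.
  apply: eq_bigr => i _; rewrite mulr_sumr -big_split/=; apply: eq_bigr => j _.
  rewrite -bl; [|exact: cbnd_coord..].
  by congr (b _ _ _ _); apply/funext => x; rewrite !mxE.
- move=> a f g g' bf bg bg'; rewrite /B mulr_sumr -big_split/=.
  apply: eq_bigr => i _; rewrite mulr_sumr -big_split/=; apply: eq_bigr => j _.
  rewrite -br; [|exact: cbnd_coord..].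
  by congr (b _ _ _ _); apply/funext => x; rewrite !mxE.
- pose C i j := sval (cid2 (bb i j)).
  have C0 i j : 0 <= C i j by rewrite /C; case: cid2.
  exists (\sum_(i < d) \sum_(j < d) C i j).
    by apply: sumr_ge0 => i _; apply: sumr_ge0.
  move=> f g M N bf bg fM gN; rewrite /B mulr_suml (le_trans (ler_norm_sum _ _ _))//.
  apply: ler_sum => i _; rewrite mulr_suml (le_trans (ler_norm_sum _ _ _))//.
  apply: ler_sum => j _; rewrite /C; case: cid2 => /= c _; apply;
    by [exact: cbnd_coord|move=> x; rewrite (le_trans (ler_coord _ _ _))].
Qed.

End double_sum.

Lemma dotv_mulmx (a b : vec) (A : 'M[R]_d) :
  dotv a (A *m b) = \sum_(i < d) \sum_(j < d) A i j * (a i 0 * b j 0).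
Proof.
rewrite /dotv; apply: eq_bigr => i _; rewrite mxE mulr_sumr.
by apply: eq_bigr => j _; ring.
Qed.

Lemma Rintegral_sum dT (T : measurableType dT) (m : {measure set T -> \bar R})
    (D : set T) n (h : 'I_n -> T -> R) : measurable D ->
  (forall i, m.-integrable D (EFin \o h i)) ->
  \int[m]_(x in D) (\sum_(i < n) h i x) = \sum_(i < n) \int[m]_(x in D) h i x.
Proof.
move=> mD hI; rewrite /Rintegral [RHS]sum_fine; last first.
  by move=> i _; exact: (integrable_fin_num mD (hI i)).
congr fine; rewrite -integral_sum//.
by apply: eq_integral => x _; rewrite sumEFin.
Qed.

Variable K : R -> 'M[R]_d.
Hypothesis K_even : forall r, K (- r) = K r.
Hypothesis K_sym : forall r, (K r)^T = K r.
Hypothesis K_L1 : kernel_L1 K.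
Hypothesis K_moment : kernel_moment K.

Let k i j r : R := K r i j.

Let keven i j r : k i j (- r) = k i j r. Proof. by rewrite /k K_even. Qed.
Let ksym i j r : k i j r = k j i r. Proof. by rewrite /k -{1}K_sym mxE. Qed.
Let kI i j : mu.-integrable setT (EFin \o k i j). Proof. exact: K_L1. Qed.

Lemma measurable_kernel_norm : measurable_fun setT ((fun r => `|K r|) : mR -> mR).
Proof.
have -> : (fun r => `|K r|) = (fun r => \big[Num.max/0]_ij `|k ij.1 ij.2 r|).
  by apply/funext => r; rewrite /Num.norm/= mx_normrE.
elim: (index_enum _) => [|ij s IH].
  by under eq_fun do rewrite big_nil; exact: measurable_cst.
under eq_fun do rewrite big_cons; apply: measurable_maxr => //.
apply: measurableT_comp => //.
by have /integrableP[/measurable_EFinP] := kI ij.1 ij.2.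
Qed.

Lemma kernel_entry_moment i j : (\int[mu]_r (`|r| * `|k i j r|)%:E < +oo)%E.
Proof.
apply: le_lt_trans K_moment.
have mk : measurable_fun setT (k i j : mR -> mR).
  by have /integrableP[/measurable_EFinP] := kI i j.
apply: ge0_le_integral => //.
- apply/measurable_EFinP; apply: measurable_funM; first exact: normr_measurable.
  exact: measurableT_comp.
- apply/measurable_EFinP; apply: measurable_funM; last exact: measurable_kernel_norm.
  by apply: measurable_funD => //; exact: normr_measurable.
move=> r _; rewrite lee_fin ler_pM//; first by rewrite lerDr.
exact: ler_coord.
Qed.
Let kmom := kernel_entry_moment.

(** All double integrals of the problem are values of this one form: the
    nonlocal Hamiltonian, the one-form and the two-form differ only in the
    functions inserted. *)
Definition quadrant_form (f g : R -> vec) : R :=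
  intQ (fun x y => dotv (f x) (K (x - y) *m g y)).

Definition conv_at0 (g : R -> vec) : vec :=
  \col_i \int[mu]_y (K (0 - y) *m g y) i 0.

Definition boundary_form (f g : R -> vec) : R := dotv (f 0) (conv_at0 g).

Lemma quadrant_form_integrable f g : cbnd f -> cbnd g ->
  (mu \x mu)%E.-integrable (`]-oo, 0[ `*` `]0, +oo[)
    (fun p => (dotv (f p.1) (K (p.1 - p.2) *m g p.2))%:E).
Proof.
move=> bf bg.
have mQ := @measurable_quadrant R.
rewrite (_ : (fun p => _) = (fun p => \sum_(i < d) \sum_(j < d)
    (k i j (p.1 - p.2) * (f p.1 i 0 * g p.2 j 0))%:E)%E); last first.
  apply/funext => p; rewrite dotv_mulmx -sumEFin; apply: eq_bigr => i _.
  by rewrite -sumEFin.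
apply: integrable_sum => // i _; apply: integrable_sum => // j _.
exact: (kernel_form_integrable (kI i j) (kmom i j) (keven i j)
  (cbnd_coord i bf) (cbnd_coord j bg)).
Qed.

Lemma quadrant_formE f g : cbnd f -> cbnd g -> quadrant_form f g =
  \sum_(i < d) \sum_(j < d) kernel_form (k i j) (fun x => f x i 0) (fun x => g x j 0).
Proof.
move=> bf bg; rewrite /quadrant_form /intQ.
under eq_Rintegral do rewrite dotv_mulmx.
have mQ := @measurable_quadrant R.
have I i j := kernel_form_integrable (kI i j) (kmom i j) (keven i j)
  (cbnd_coord i bf) (cbnd_coord j bg).
rewrite Rintegral_sum//; last first.
  move=> i; rewrite (_ : _ \o _ = (fun p => \sum_(j < d)
    (k i j (p.1 - p.2) * (f p.1 i 0 * g p.2 j 0))%:E)%E).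
    by apply: integrable_sum => // j _; exact: I.
  by apply/funext => p; rewrite sumEFin.
by apply: eq_bigr => i _; rewrite Rintegral_sum// => j; exact: I.
Qed.

Lemma boundary_formE f g : cbnd g -> boundary_form f g =
  \sum_(i < d) \sum_(j < d) f 0 i 0 * \int[mu]_r (k i j r * g r j 0).
Proof.
move=> bg; rewrite /boundary_form /dotv; apply: eq_bigr => i _.
rewrite mxE -mulr_sumr; congr (_ * _).
rewrite -Rintegral_sum//; last first.
  by move=> j; exact: (conv_integrable (kI i j) (cbnd_coord j bg)).
by apply: eq_Rintegral => r _; rewrite mxE; apply: eq_bigr => j _; rewrite sub0r K_even.
Qed.

Lemma quadrant_form_bilinear : bounded_bilinear quadrant_form.
Proof.
have [l r b] : bounded_bilinear (fun f g => \sum_(i < d) \sum_(j < d)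
    kernel_form (k i j) (fun x => f x i 0) (fun x => g x j 0)).
  apply: (double_sum_bounded_bilinear (b := fun i j => kernel_form (k i j))) => i j.
  - by move=> *; exact: (kernel_form_linl (kI i j) (kmom i j) (keven i j)).
  - by move=> *; exact: (kernel_form_linr (kI i j) (kmom i j) (keven i j)).
  - exact: (kernel_form_bound (kI i j) (kmom i j) (keven i j)).
split.
- move=> a f f' g bf bf' bg; rewrite !quadrant_formE//; first exact: l.
  by apply: cbndD => //; exact: cbndZ.
- move=> a f g g' bf bg bg'; rewrite !quadrant_formE//; first exact: r.
  by apply: cbndD => //; exact: cbndZ.
- have [C C0 H] := b; exists C => // f g M N bf bg fM gN.
  by rewrite quadrant_formE//; exact: H.
Qed.

Lemma boundary_form_bilinear : bounded_bilinear boundary_form.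
Proof.
have [l r b] : bounded_bilinear (fun f g : R -> vec => \sum_(i < d) \sum_(j < d)
    f 0 i 0 * \int[mu]_r (k i j r * g r j 0)).
  apply: (double_sum_bounded_bilinear (b := fun i j p q =>
    p 0 * \int[mu]_r (k i j r * q r))) => i j.
  - by move=> a f f' g _ _ _; ring.
  - by move=> a f g g' bf bg bg'; rewrite (conv_lin (kI i j))//; ring.
  - have [C C0 H] := conv_bound (kI i j).
    exists C => // f g M N bf bg fM gN; rewrite normrM mulrCA ler_pM//.
    exact: H.
split.
- move=> a f f' g bf bf' bg; rewrite !boundary_formE//; exact: l.
- move=> a f g g' bf bg bg'; rewrite !boundary_formE//; first exact: r.
  by apply: cbndD => //; exact: cbndZ.
- have [C C0 H] := b; exists C => // f g M N bf bg fM gN.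
  by rewrite boundary_formE//; exact: H.
Qed.

Lemma dotv_kernel_sym (a b : vec) r : dotv a (K r *m b) = dotv b (K r *m a).
Proof.
rewrite !dotv_mulmx exchange_big/=; apply: eq_bigr => i _; apply: eq_bigr => j _.
by rewrite -{1}K_sym mxE; ring.
Qed.

(** Componentwise this is the scalar identity: the terms with f and g exchanged
    carry the transposed pair of indices, and K r is symmetric. *)
Lemma quadrant_form_antisym (f f' g g' : R -> vec) :
  (forall x : R, is_derive x (1 : R) f (f' x)) ->
  (forall x : R, is_derive x (1 : R) g (g' x)) ->
  cbnd f -> cbnd f' -> cbnd g -> cbnd g' ->
  quadrant_form f g' + quadrant_form f' g - quadrant_form g f' - quadrant_form g' f =
  boundary_form f g - boundary_form g f.
Proof.
move=> df dg bf bf' bg bg'.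
have dc (h h' : R -> vec) i : (forall x : R, is_derive x (1 : R) h (h' x)) ->
    forall x : R, is_derive x (1 : R) (fun x => h x i 0 : R) (h' x i 0).
  move=> dh x; have [hx hE] := dh x; apply: DeriveDef.
    exact: (derivable_mxP _ _ _).1.
  by rewrite -hE derive_mx// mxE.
have swap p q : cbnd p -> cbnd q -> quadrant_form p q =
    \sum_(i < d) \sum_(j < d) kernel_form (k i j) (fun x => p x j 0) (fun x => q x i 0).
  move=> bp bq; rewrite quadrant_formE// exchange_big/=.
  apply: eq_bigr => i _; apply: eq_bigr => j _; congr (kernel_form _ _ _).
  by apply/funext => r; exact: ksym.
have swap' p q : cbnd p -> cbnd q -> boundary_form p q =
    \sum_(i < d) \sum_(j < d) p 0 j 0 * \int[mu]_r (k i j r * q r i 0).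
  move=> bp bq; rewrite boundary_formE// exchange_big/=.
  apply: eq_bigr => i _; apply: eq_bigr => j _; congr (_ * _).
  by apply: eq_Rintegral => r _; rewrite ksym.
rewrite (quadrant_formE bf bg') (quadrant_formE bf' bg) (swap _ _ bg bf') (swap _ _ bg' bf).
rewrite (boundary_formE _ bg) (swap' _ _ bg bf).
rewrite -big_split -!sumrB/=; apply: eq_bigr => i _.
rewrite -big_split -!sumrB/=; apply: eq_bigr => j _.
exact: (kernel_form_antisym (kI i j) (kmom i j) (keven i j) (dc _ _ i df) (dc _ _ j dg)
  (cbnd_coord i bf) (cbnd_coord i bf') (cbnd_coord j bg) (cbnd_coord j bg')).
Qed.

End bilinear.

(** * Mean values and uniformity on balls *)

Section calculus.
Context {R : realType}.

Lemma is_derive_line (V W : normedModType R) (f : V -> W) (q h : V) (t : R) :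
  derivable f (q + t *: h) h ->
  is_derive t (1 : R) (fun s : R => f (q + s *: h)) ('D_h f (q + t *: h)).
Proof.
move=> df.
have E : (fun s : R => s^-1 *: (((fun s : R => f (q + s *: h)) \o shift t) (s *: (1 : R)) -
    f (q + t *: h))) =
  (fun s : R => s^-1 *: ((f \o shift (q + t *: h)) (s *: h) - f (q + t *: h))).
  apply/funext => s /=; congr (_ *: (f _ - _)).
  by rewrite [s *: _]mulr1 scalerDl addrCA.
by apply: DeriveDef; rewrite /derivable /derive E.
Qed.

Lemma mean_value_line (V : normedModType R) (f : V -> R) (q h : V) :
  (forall p, derivable f p h) ->
  exists2 t : R, 0 <= t <= 1 & f (q + h) - f q = 'D_h f (q + t *: h).
Proof.
move=> df; have dF (t : R) := is_derive_line (df (q + t *: h)).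
have [|t] := @MVT_segment R (fun s => f (q + s *: h)) _ 0 1 ler01 (fun x _ => dF x).
  apply: derivable_within_continuous => x _; by have [] := dF x.
rewrite in_itv/= scale0r addr0 scale1r subr0 mulr1 => t01 E.
by exists t.
Qed.

Section cV.
Context {d : nat}.
Notation vec := 'cV[R]_d.
Implicit Types (f : vec -> R) (p q h : vec).

Notation ej j := (delta_mx j 0 : vec).

Lemma closed_ball_compact_cV (M : R) : compact [set p : vec | `|p| <= M].
Proof.
have H : compact [set v : 'rV[R]_d | forall i, (v ord0 i) \in `[- M, M]].
  by apply: (@rV_compact R d (fun=> `[- M, M]%classic)) => _; exact: segment_compact.
have [M0|M0] := ltP M 0.
  rewrite (_ : [set _ | _] = set0); first exact: compact0.
  apply/seteqP; split => p //= pM.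
  by have := le_lt_trans pM M0; rewrite normr_lt0.
rewrite (_ : [set _ | _] = (fun v : 'rV[R]_d => v^T : vec) @`
    [set v : 'rV[R]_d | forall i, (v ord0 i) \in `[- M, M]]).
  apply: continuous_compact H.
  apply: continuous_subspaceT => v A /nbhs_ballP[e e0 eA].
  apply/nbhs_ballP; exists e => // w; rewrite -ball_normE /= => vw; apply: eA.
  rewrite -ball_normE/=; apply: le_lt_trans vw; apply: mx_norm_le => // i j.
  by have := ler_coord (v - w) j i; rewrite !mxE.
apply/seteqP; split => [p pM|_ [v vM <-]] /=.
  exists p^T; last by rewrite trmxK.
  move=> i; rewrite /= in_itv/= -ler_norml mxE.
  exact: le_trans (ler_coord _ _ _) pM.
apply: cV_norm_le => // i; rewrite mxE; have := vM i.
by rewrite in_itv/= -ler_norml.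
Qed.

(** Compactness of balls of a finite-dimensional space, in the form used for
    moduli of continuity and differentiability: a property that holds locally
    with a radius holds on a ball with a common radius. *)
Lemma uniform_on_balls (P : R -> vec -> Prop) (M : R) :
  (forall r s p, r <= s -> P s p -> P r p) ->
  (forall p, exists2 r, 0 < r & forall q, `|q - p| < r -> P r q) ->
  exists2 r, 0 < r & forall p, `|p| <= M -> P r p.
Proof.
move=> Pmono Ploc.
have /compact_near_coveringP := @closed_ball_compact_cV M.
move=> /(_ R (0 : R)^'+ P _) H.
have {}H : \forall r \near (0 : R)^'+, [set p | `|p| <= M] `<=` P r.
  apply: H => p _; have [r r0 rP] := Ploc p.
  exists ([set q | `|q - p| < r], [set s | s < r]) => /=.
    split; last by apply: nbhs_right_lt.
    apply/nbhs_ballP; exists r => // q; rewrite -ball_normE/= distrC//.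
  by move=> [q s] /= [qp sr]; apply: (Pmono _ _ _ (ltW sr)); exact: rP.
have [r [r0 rP]] := filter_ex (filterI (nbhs_right_gt (0 : R)) H).
by exists r.
Qed.

Lemma diff_coord f p h : differentiable f p ->
  'd f p h = \sum_(j < d) h j 0 * 'D_(ej j) f p.
Proof.
move=> df; rewrite {1}(_ : h = \sum_(j < d) h j 0 *: ej j).
  rewrite linear_sum/=; apply: eq_bigr => j _.
  by rewrite linearZ deriveE.
rewrite {1}[h]matrix_sum_delta; apply: eq_bigr => j _.
by rewrite big_ord1.
Qed.

(** For a C^1 function the increment f(q+h) - f(q) is df at an intermediate
    point, which is close to df at q uniformly for q near p. *)
Lemma strict_diff f p (e : R) : Ck 1 f -> 0 < e ->
  exists2 r, 0 < r & forall q h, `|q - p| < r -> `|h| <= r ->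
    `|f (q + h) - f q - 'd f q h| <= e * `|h|.
Proof.
move=> [df cf] e0.
(* each of the d partial derivatives moves by less than e' from q to p and
   again from p to the intermediate point; d.+1 also covers d = 0 *)
pose e' := e / (2 * d.+1%:R).
have e'0 : 0 < e' by rewrite divr_gt0// mulr_gt0.
have near_j j : \forall q \near nbhs p, `|'D_(ej j) f p - 'D_(ej j) f q| < e'.
  by have /cvgrPdist_lt/(_ _ e'0) := cf (ej j) p.
have near_all : nbhs p (fun q => forall j, `|'D_(ej j) f p - 'D_(ej j) f q| < e').
  exact: filter_forall near_j.
have [r /= r0 rH] := (nbhs_ballP _ _).1 near_all.
exists (r / 2) => [|q h qp hr]; first by rewrite divr_gt0.
have [t /andP[t0 t1] ->] := mean_value_line q (fun p0 => @diff_derivable _ _ _ f p0 h (df p0)).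
have D1 : 'D_h f (q + t *: h) = \sum_(j < d) h j 0 * 'D_(ej j) f (q + t *: h).
  by rewrite -diff_coord; [apply: deriveE|]; exact: df.
have D2 : 'd f q h = \sum_(j < d) h j 0 * 'D_(ej j) f q by exact: diff_coord.
rewrite D1 D2 -sumrB; apply: (le_trans (ler_norm_sum _ _ _)).
apply: (@le_trans _ _ (\sum_(j < d) `|h| * (e' + e'))).
  apply: ler_sum => j _; rewrite -mulrBr normrM ler_pM// ?ler_coord//.
  rewrite -(subrKA ('D_(ej j) f p)) (le_trans (ler_normD _ _))// lerD//.
    rewrite distrC ltW//; apply: rH; rewrite -ball_normE/=.
    rewrite opprD addrA (le_lt_trans (ler_normB _ _))//.
    rewrite (splitr r) ltr_leD//; first by rewrite distrC.
    rewrite normrZ ger0_norm// (le_trans _ hr)//.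
    by rewrite -[leRHS]mul1r ler_wpM2r.
  rewrite ltW//; apply: rH; rewrite -ball_normE/= distrC (lt_trans qp)//.
  by rewrite ltr_pdivrMr// ltr_pMr// ltr1n.
rewrite sumr_const card_ord -mulr_natl mulrCA mulrC ler_wpM2r//.
have -> : e' + e' = e / d.+1%:R by rewrite /e' invfM mulrA -mulrDl -splitr.
rewrite mulrCA -[leRHS]mulr1 ler_wpM2l ?(ltW e0)// ler_pdivrMr// mul1r.
by rewrite ler_nat.
Qed.

End cV.
End calculus.

(** * Uniform first-order expansions of C^2 maps *)

Section uniform.
Context {R : realType}.

Lemma pos_forall (I : finType) (Q : I -> R -> Prop) :
  (forall i r s, r <= s -> Q i s -> Q i r) ->
  (forall i, exists2 r : R, 0 < r & Q i r) -> exists2 r, 0 < r & forall i, Q i r.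
Proof.
move=> Qmono Qex.
have H i : \forall r \near (0 : R)^'+, Q i r.
  have [r r0 Qr] := Qex i.
  by near=> s; apply: (Qmono _ _ _ _ Qr); near: s; exact: nbhs_right_le.
have [r [r0 rQ]] := filter_ex (filterI (nbhs_right_gt (0 : R)) (filter_forall _ H)).
by exists r.
Unshelve. all: by end_near. Qed.

Context {d : nat}.
Notation vec := 'cV[R]_d.
Notation ej j := (delta_mx j 0 : vec).

Lemma uniform_diff (f : vec -> R) (M e : R) : Ck 1 f -> 0 < e ->
  exists2 r : R, 0 < r & forall p, `|p| <= M -> forall h, `|h| <= r ->
    `|f (p + h) - f p - 'd f p h| <= e * `|h|.
Proof.
move=> Cf e0; apply: (uniform_on_balls (P := fun r p => forall h, `|h| <= r ->
    `|f (p + h) - f p - 'd f p h| <= e * `|h|)).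
  by move=> r s p rs H h hr; apply: H; exact: le_trans rs.
move=> p; have [r r0 H] := strict_diff p Cf e0.
by exists r => // q qp h hr; exact: H.
Qed.

Lemma uniform_cont (f : vec -> R) (M e : R) : continuous f -> 0 < e ->
  exists2 r : R, 0 < r & forall p, `|p| <= M -> forall h, `|h| <= r ->
    `|f (p + h) - f p| <= e.
Proof.
move=> cf e0; apply: (uniform_on_balls (P := fun r p => forall h, `|h| <= r ->
    `|f (p + h) - f p| <= e)).
  by move=> r s p rs H h hr; apply: H; exact: le_trans rs.
move=> p; have e20 : 0 < e / 2 by rewrite divr_gt0.
have /cvgrPdist_lt/(_ _ e20) := cf p.
case/nbhs_ballP => r /= r0 rH; exists (r / 2); first by rewrite divr_gt0.
move=> q qp h hr; rewrite -(subrKA (f p)) (le_trans (ler_normD _ _))//.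
rewrite (splitr e) lerD//; last first.
  rewrite ltW//; apply: rH; rewrite -ball_normE/= distrC (lt_trans qp)//.
  by rewrite ltr_pdivrMr// ltr_pMr// ltr1n.
rewrite distrC ltW//; apply: rH; rewrite -ball_normE/=.
rewrite opprD addrA (le_lt_trans (ler_normB _ _))//.
by rewrite (splitr r) ltr_leD// distrC.
Qed.

Lemma bounded_on_balls (f : vec -> R) (M : R) : continuous f ->
  exists2 C : R, 0 <= C & forall p, `|p| <= M -> `|f p| <= C.
Proof.
move=> cf.
have /compact_bounded[C [_ CH]] :=
  continuous_compact (continuous_subspaceT cf) (@closed_ball_compact_cV R d M).
exists (`|C| + 1) => [|p pM]; first by rewrite addr_ge0.
apply: CH; last by exists p.
by rewrite (le_lt_trans (ler_norm _))// ltrDl.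
Qed.

Lemma mulmx_norm_le (A : 'M[R]_d) (h : vec) (C : R) :
  (forall i j, `|A i j| <= C) -> `|A *m h| <= d%:R * C * `|h|.
Proof.
move=> AC; have [C0|] := leP 0 C; last first.
  move=> C0; have d0 : d = 0.
    case: d A h AC C0 => // n A h AC C0.
    by have := le_lt_trans (AC 0 0) C0; rewrite normr_lt0.
  move: A h AC C0; rewrite d0 => A h _ _.
  by rewrite mul0r mul0r; apply: cV_norm_le => // -[].
apply: cV_norm_le => [|i]; first by rewrite !mulr_ge0.
rewrite mxE (le_trans (ler_norm_sum _ _ _))//.
apply: (@le_trans _ _ (\sum_(j < d) C * `|h|)).
  by apply: ler_sum => j _; rewrite normrM ler_pM// ler_coord.
by rewrite sumr_const card_ord -[leLHS]mulr_natl mulrA.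
Qed.

Lemma Jac_mul (S : vec -> vec) p h : differentiable S p -> Jac S p *m h = 'd S p h.
Proof.
move=> dS; rewrite {2}(_ : h = \sum_(j < d) h j 0 *: ej j); last first.
  by rewrite {1}[h]matrix_sum_delta; apply: eq_bigr => j _; rewrite big_ord1.
rewrite linear_sum/=; apply/colP => i; rewrite mxE summxE.
by apply: eq_bigr => j _; rewrite linearZ !mxE mulrC.
Qed.

Lemma Ck_coord n (S : vec -> vec) i : Ck n S -> Ck n (fun p => S p i 0 : R).
Proof.
elim: n S => [S cS p|n IH S [dS cS]].
  by apply: (@continuous_comp _ _ _ S (fun N : vec => N i 0)); [exact: cS|exact: coord_continuous].
split=> [p|v].
  apply: (@differentiable_comp _ _ _ _ S (fun N : vec => N i 0)); first exact: dS.
  exact: differentiable_coord.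
rewrite (_ : 'D_v _ = (fun x => 'D_v S x i 0)); first exact: IH _ (cS v).
apply/funext => x; rewrite derive_mx ?mxE//; exact: diff_derivable.
Qed.

Section C2.
Variable S : vec -> vec.
Hypothesis S_C2 : Ck 2 S.

Lemma C2_differentiable p : differentiable S p. Proof. by have [] := S_C2. Qed.

Lemma Jac_coordE i j : (fun p => Jac S p i j) = 'D_(ej j) (fun p => S p i 0 : R).
Proof.
apply/funext => p; rewrite mxE -deriveE; last exact: C2_differentiable.
by rewrite derive_mx ?mxE//; apply: diff_derivable; exact: C2_differentiable.
Qed.

Lemma Jac_C1 i j : Ck 1 (fun p => Jac S p i j).
Proof. by rewrite Jac_coordE; have [_] := Ck_coord i S_C2; apply. Qed.

Lemma Jac_cont i j : continuous (fun p => Jac S p i j).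
Proof.
by move=> p; apply: differentiable_continuous; have [dJ _] := Jac_C1 i j; exact: dJ.
Qed.

Lemma coord_C1 i : Ck 1 (fun p => S p i 0 : R).
Proof.
have [dS cS] := Ck_coord i S_C2; split => // v p.
by apply: differentiable_continuous; have [dJ _] := cS v; exact: dJ.
Qed.

(** The derivative in direction h of p |-> DS(p) c, that is D^2S(p)[h, c]. *)
Definition hess (p h c : vec) : vec :=
  \col_i \sum_(j < d) 'd (fun p => Jac S p i j) p h * c j 0.

Lemma uniform_diff_C2 (M e : R) : 0 < e ->
  exists2 r : R, 0 < r & forall p, `|p| <= M -> forall h, `|h| <= r ->
    `|S (p + h) - S p - Jac S p *m h| <= e * `|h|.
Proof.
move=> e0.
have [|i|r r0 H] := @pos_forall 'I_d (fun i r => forall p, `|p| <= M -> forall h, `|h| <= r ->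
    `|S (p + h) i 0 - S p i 0 - (Jac S p *m h) i 0| <= e * `|h|).
- by move=> i r s rs H p pM h hr; apply: H => //; exact: le_trans rs.
- have [r r0 H] := uniform_diff M (coord_C1 i) e0; exists r => // p pM h hr.
  suff -> : (Jac S p *m h) i 0 = 'd (fun p => S p i 0 : R) p h by exact: H.
  rewrite diff_coord; last by have [dS _] := coord_C1 i; exact: dS.
  rewrite mxE; apply: eq_bigr => j _.
  by rewrite -[Jac S p i j]/((fun p => Jac S p i j) p) Jac_coordE mulrC.
exists r => // p pM h hr; apply: cV_norm_le => [|i]; first by rewrite mulr_ge0// ltW.
have <- : S (p + h) i 0 - S p i 0 - (Jac S p *m h) i 0 =
    (S (p + h) - S p - Jac S p *m h) i 0 by rewrite !mxE.
exact: H.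
Qed.

Lemma Jac_bound (M : R) : exists2 C : R, 0 <= C & forall p, `|p| <= M -> forall h : vec,
  `|Jac S p *m h| <= C * `|h|.
Proof.
pose C (ij : 'I_d * 'I_d) := sval (cid2 (bounded_on_balls M (Jac_cont (i:=ij.1) (j:=ij.2)))).
have C0 ij : 0 <= C ij by rewrite /C; case: cid2.
exists (d%:R * \sum_ij C ij) => [|p pM h].
  by rewrite mulr_ge0// sumr_ge0.
apply: mulmx_norm_le => i j; rewrite (bigD1 (i, j))//=.
apply: le_trans (_ : C (i, j) <= _); last by rewrite lerDl sumr_ge0.
by rewrite /C; case: cid2 => /= c c0; apply.
Qed.

Lemma Jac_uniform_cont (M e : R) : 0 < e ->
  exists2 r : R, 0 < r & forall p, `|p| <= M -> forall h, `|h| <= r -> forall c : vec,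
    `|(Jac S (p + h) - Jac S p) *m c| <= e * `|c|.
Proof.
move=> e0; have e'0 : 0 < e / d.+1%:R by rewrite divr_gt0.
have [|ij|r r0 H] := @pos_forall ('I_d * 'I_d)%type (fun ij r => forall p, `|p| <= M -> forall h, `|h| <= r ->
    `|Jac S (p + h) ij.1 ij.2 - Jac S p ij.1 ij.2| <= e / d.+1%:R).
- by move=> i r s rs H p pM h hr; apply: H => //; exact: le_trans rs.
- exact: (uniform_cont M (Jac_cont (i:=ij.1) (j:=ij.2)) e'0).
exists r => // p pM h hr c.
apply: (le_trans (mulmx_norm_le (C := e / d.+1%:R) _ _)).
  by move=> i j; rewrite mxE [X in _ + X]mxE; exact: (H (i, j) p pM h hr).
rewrite ler_wpM2r// mulrCA -[leRHS]mulr1 ler_wpM2l ?(ltW e0)//.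
by rewrite ler_pdivrMr// mul1r ler_nat.
Qed.

Lemma Jac_uniform_diff (M e : R) : 0 < e ->
  exists2 r : R, 0 < r & forall p, `|p| <= M -> forall h, `|h| <= r -> forall c : vec,
    `|(Jac S (p + h) - Jac S p) *m c - hess p h c| <= e * `|h| * `|c|.
Proof.
move=> e0; have e'0 : 0 < e / d.+1%:R by rewrite divr_gt0.
have [|ij|r r0 H] := @pos_forall ('I_d * 'I_d)%type (fun ij r => forall p, `|p| <= M -> forall h, `|h| <= r ->
    `|Jac S (p + h) ij.1 ij.2 - Jac S p ij.1 ij.2 - 'd (fun p => Jac S p ij.1 ij.2) p h| <= e / d.+1%:R * `|h|).
- by move=> i r s rs H p pM h hr; apply: H => //; exact: le_trans rs.
- exact: (uniform_diff M (Jac_C1 ij.1 ij.2) e'0).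
exists r => // p pM h hr c.
pose A := \matrix_(i, j) (Jac S (p + h) i j - Jac S p i j - 'd (fun p => Jac S p i j) p h).
rewrite (_ : _ - _ = A *m c); last first.
  apply/colP => i.
  have -> : ((Jac S (p + h) - Jac S p) *m c - hess p h c) i 0 =
      ((Jac S (p + h) - Jac S p) *m c) i 0 - hess p h c i 0.
    by rewrite mxE; congr (_ + _); rewrite mxE.
  rewrite 2!mxE [RHS]mxE -sumrB; apply: eq_bigr => j _.
  rewrite -mulrBl; congr (_ * _); rewrite [RHS]mxE; congr (_ - _).
  by rewrite [LHS]mxE; congr (_ + _); rewrite mxE.
apply: (le_trans (mulmx_norm_le (C := e / d.+1%:R * `|h|) _ _)).
  by move=> i j; rewrite mxE; exact: (H (i, j) p pM h hr).
rewrite ler_wpM2r// mulrA ler_wpM2r// mulrCA -[leRHS]mulr1 ler_wpM2l ?(ltW e0)//.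
by rewrite ler_pdivrMr// mul1r ler_nat.
Qed.

End C2.
End uniform.

(** * Symmetry of second derivatives *)

Section schwarz.
Context {R : realType} {V : normedModType R}.
Variable f : V -> R.
Hypothesis fC2 : Ck 2 f.

Let df p : differentiable f p. Proof. by have [] := fC2. Qed.
Let ddf v p : differentiable ('D_v f) p.
Proof. by have [_ /(_ v)[]] := fC2. Qed.
Let cddf v w : continuous ('D_w ('D_v f)).
Proof. by have [_ /(_ v)[_]] := fC2; apply. Qed.

(** Both iterated derivatives are values, at nearby points, of the same second
    difference, which is symmetric in v and w. *)
Lemma second_difference (p v w : V) : exists s t : R,
  [/\ 0 <= s <= 1, 0 <= t <= 1 &
   f (p + v + w) - f (p + v) - (f (p + w) - f p) =
   'D_w ('D_v f) (p + s *: v + t *: w)].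
Proof.
have shiftE q : (fun h : R => h^-1 *: (((fun q => f (q + w)) \o shift q) (h *: v) -
    f (q + w))) = (fun h : R => h^-1 *: ((f \o shift (q + w)) (h *: v) - f (q + w))).
  by apply/funext => h /=; rewrite addrA.
have dw q : derivable (fun q => f (q + w)) q v.
  by rewrite /derivable shiftE; apply: diff_derivable.
have Ew q : 'D_v (fun q => f (q + w)) q = 'D_v f (q + w).
  by rewrite /derive shiftE.
have dF q : derivable ((fun q => f (q + w)) - f) q v.
  by apply: derivableB; [exact: dw|exact: diff_derivable].
have [s s01 E] := mean_value_line p dF.
have [t t01 E'] := mean_value_line (p + s *: v)
  (fun q => @diff_derivable _ _ _ ('D_v f) q w (ddf v q)).
exists s, t; split => //; rewrite -E' -Ew -deriveB -?E//; exact: diff_derivable.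
Qed.

Lemma derive_scale_dir (g : V -> R) (t : R) v q : differentiable g q ->
  'D_(t *: v) g q = t * 'D_v g q.
Proof. by move=> dg; rewrite !deriveE// linearZ. Qed.

(** Schwarz's theorem: the second differences along t v and t w, divided by
    t^2, are values of both mixed derivatives near p. *)
Lemma derive_schwarz (p v w : V) : 'D_w ('D_v f) p = 'D_v ('D_w f) p.
Proof.
apply/eqP; rewrite -subr_eq0 -normr_le0 leNgt; apply/negP.
set e := `|_| => e0; have e20 : 0 < e / 2 by rewrite divr_gt0.
have close a b : exists2 r : R, 0 < r & forall q, `|q - p| < r ->
    `|'D_a ('D_b f) p - 'D_a ('D_b f) q| < e / 2.
  have /cvgrPdist_lt/(_ _ e20)/nbhs_ballP[r /= r0 rH] := @cddf b a p.
  by exists r => // q qp; apply: rH; rewrite -ball_normE/= distrC.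
have [r1 r10 H1] := close w v; have [r2 r20 H2] := close v w.
pose D := `|v| + `|w| + 1; have D0 : 0 < D by rewrite ltr_wpDl// addr_ge0.
(* t is small enough for p + t v + t w, and every point in between, to lie
   where both mixed derivatives are within e / 2 of their value at p *)
have [t t0 tD] : exists2 t : R, 0 < t & t * D = Num.min r1 r2.
  exists (Num.min r1 r2 / D); last by rewrite divfK// gt_eqF.
  by rewrite divr_gt0// lt_min r10.
have near_p (s s' : R) a b : `|a| + `|b| < D -> 0 <= s <= 1 -> 0 <= s' <= 1 ->
    `|p + s *: (t *: a) + s' *: (t *: b) - p| < Num.min r1 r2.
  move=> abD /andP[s0 s1] /andP[s'0 s'1].
  rewrite addrAC (addrC p) addrK (le_lt_trans (ler_normD _ _))// !normrZ.
  rewrite (ger0_norm s0) (ger0_norm s'0) (gtr0_norm t0).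
  apply: (@le_lt_trans _ _ (t * (`|a| + `|b|))).
    rewrite mulrDr lerD//; by rewrite -[leRHS]mul1r ler_wpM2r// mulr_ge0// ltW.
  by rewrite -tD ltr_pM2l.
have tt (a b q : V) : 'D_(t *: b) ('D_(t *: a) f) q = t * (t * 'D_b ('D_a f) q).
  have -> : 'D_(t *: a) f = t *: 'D_a f.
    by apply/funext => q'; exact: derive_scale_dir.
  have dda := ddf a q.
  rewrite derive_scale_dir; last exact: differentiableZ.
  by rewrite deriveZ//; exact: diff_derivable.
have [s [s' [s01 s'01 E]]] := second_difference p (t *: v) (t *: w).
have [z [z' [z01 z'01 E']]] := second_difference p (t *: w) (t *: v).
rewrite tt in E; rewrite tt in E'.
have EE : 'D_w ('D_v f) (p + s *: (t *: v) + s' *: (t *: w)) =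
       'D_v ('D_w f) (p + z *: (t *: w) + z' *: (t *: v)).
  have tn0 : t != 0 by rewrite gt_eqF.
  apply: (mulfI tn0); apply: (mulfI tn0).
  refine (etrans (esym E) (etrans _ E')).
  by rewrite (addrAC p); ring.
have vwD : `|v| + `|w| < D by rewrite /D ltrDl.
have wvD : `|w| + `|v| < D by rewrite addrC.
have := near_p _ _ _ _ vwD s01 s'01; rewrite lt_min => /andP[/H1 A1 _].
have := near_p _ _ _ _ wvD z01 z'01; rewrite lt_min => /andP[_ /H2 A2].
rewrite EE in A1; move: A1 A2; rewrite /e.
move: ('D_w _ p) ('D_v _ p) ('D_v _ _) => x y c xc yc.
have := ler_distD c x y; rewrite (distrC c y) leNgt => /negP; apply.
by rewrite [ltRHS]splitr ltrD.
Qed.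

End schwarz.

(** * Superposition of bounded continuous functions with C^2 maps *)

Section superposition.
Context {R : realType} {d : nat}.
Notation vec := 'cV[R]_d.
Notation ej j := (delta_mx j 0 : vec).
Variable S : vec -> vec.
Hypothesis S_C2 : Ck 2 S.

Lemma hessE p h c i : hess S p h c i 0 =
  \sum_(j < d) \sum_(l < d) h l 0 * 'D_(ej l) (fun q => Jac S q i j) p * c j 0.
Proof.
rewrite mxE; apply: eq_bigr => j _; rewrite diff_coord ?mulr_suml//.
by have [dJ _] := Jac_C1 S_C2 i j; exact: dJ.
Qed.

Lemma hess_sym p h c : hess S p h c = hess S p c h.
Proof.
apply/colP => i; rewrite !hessE exchange_big/=; apply: eq_bigr => l _.
apply: eq_bigr => j _; rewrite !(Jac_coordE S_C2).
rewrite (derive_schwarz (Ck_coord i S_C2)); ring.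
Qed.

Lemma cbnd_coordP (f : R -> vec) :
  (forall i, cbnd (fun x => f x i 0 : R)) -> cbnd f.
Proof.
move=> bf; split.
  move=> x; apply/cvgrPdist_lt => e e0.
  have H i : \forall y \near nbhs x, `|f x i 0 - f y i 0| < e / 2.
    have e20 : 0 < e / 2 by rewrite divr_gt0.
    by have [/(_ x)/cvgrPdist_lt/(_ _ e20)] := bf i.
  apply: filterS (filter_forall _ H) => y Hy.
  apply: (@le_lt_trans _ _ (e / 2)); last by rewrite ltr_pdivrMr// ltr_pMr// ltr1n.
  apply: cV_norm_le => [|i]; first by rewrite divr_ge0// ltW.
  by have := ltW (Hy i); rewrite !mxE.
pose C i := sval (cid (bf i).2).
exists (\sum_i `|C i|) => x; apply: cV_norm_le => [|i]; first exact: sumr_ge0.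
rewrite (bigD1 i)//=; apply: le_trans (_ : `|C i| <= _); last by rewrite lerDl sumr_ge0.
by rewrite /C; case: cid => M /= fM; rewrite (le_trans (fM x))// ler_norm.
Qed.

Lemma cbndM (f g : R -> R) : cbnd f -> cbnd g -> cbnd (fun x => f x * g x).
Proof.
move=> [cf [M fM]] [cg [N gN]]; split.
  by move=> x; apply: cvgM; [exact: cf|exact: cg].
by exists (M * N) => x; rewrite normrM ler_pM.
Qed.

Lemma cbnd_sum n (f : 'I_n -> R -> R) : (forall i, cbnd (f i)) ->
  cbnd (fun x => \sum_(i < n) f i x).
Proof.
move=> bf; elim: n f bf => [|n IH] f bf.
  under eq_fun do rewrite big_ord0.
  by split; [move=> x; exact: cvg_cst|exists 0 => x; rewrite normr0].
under eq_fun do rewrite big_ord_recr.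
have [c1 [M HM]] := IH _ (fun i => bf (widen_ord (leqnSn n) i)).
have [c2 [N HN]] := bf ord_max; split.
  by move=> x; apply: cvgD; [exact: c1|exact: c2].
by exists (M + N) => x; rewrite (le_trans (ler_normD _ _))// lerD.
Qed.

Lemma cbnd_comp (g : vec -> R) (u : R -> vec) : continuous g -> cbnd u ->
  cbnd (fun x => g (u x)).
Proof.
move=> cg [cu [M uM]]; split.
  by move=> x; apply: (@continuous_comp _ _ _ u g); [exact: cu|exact: cg].
by have [C _ H] := bounded_on_balls M cg; exists C => x; exact: H.
Qed.

Lemma cbnd_S (u : R -> vec) : cbnd u -> cbnd (S \o u).
Proof.
move=> bu; apply: cbnd_coordP => i.
apply: (@cbnd_comp (fun p => S p i 0)) => // p.
by apply: differentiable_continuous; have [dS _] := coord_C1 S_C2 i; exact: dS.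
Qed.

Lemma cbnd_Jac (u v : R -> vec) : cbnd u -> cbnd v ->
  cbnd (fun x => Jac S (u x) *m v x).
Proof.
move=> bu bv; apply: cbnd_coordP => i.
under eq_fun do rewrite mxE.
apply: cbnd_sum => j; apply: cbndM; last exact: cbnd_coord.
exact: (@cbnd_comp (fun p => Jac S p i j)) (Jac_cont S_C2 (i:=i) (j:=j)) bu.
Qed.

Lemma cbnd_hess (u v w : R -> vec) : cbnd u -> cbnd v -> cbnd w ->
  cbnd (fun x => hess S (u x) (v x) (w x)).
Proof.
move=> bu bv bw; apply: cbnd_coordP => i.
under eq_fun do rewrite hessE.
apply: cbnd_sum => j; apply: cbnd_sum => l; apply: cbndM; last exact: cbnd_coord.
apply: cbndM; first exact: cbnd_coord.
have [_ cJ] := Jac_C1 S_C2 i j.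
exact: (@cbnd_comp ('D_(ej l) (fun q => Jac S q i j))) (cJ _) bu.
Qed.

Lemma is_derive_comp_Jac (u : R -> vec) (x : R) : derivable u x (1 : R) ->
  is_derive x (1 : R) (S \o u) (Jac S (u x) *m derive1 u x).
Proof.
move=> /derivable1_diffP du; have dS := C2_differentiable S_C2 (u x).
have dc : differentiable (S \o u) x by exact: differentiable_comp.
apply: DeriveDef; first exact: diff_derivable.
by rewrite deriveE// diff_comp//= Jac_mul// derive1E deriveE.
Qed.

End superposition.

(** * Frechet derivatives from estimates *)

Section frechet.
Context {R : realType}.

Lemma frechet_differentiable_eps (V W : normedModType R) (f : V -> W) (x : V)
    (L : {linear V -> W}) :
  (exists C : R, forall h, `|L h| <= C * `|h|) ->
  (forall e : R, 0 < e -> exists2 r : R, 0 < r & forall h, `|h| < r ->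
    `|f (x + h) - f x - L h| <= e * `|h|) ->
  differentiable f x /\ 'd f x = L :> (V -> W).
Proof.
move=> [C LC] fL.
have cL : continuous L.
  move=> y; apply/cvgrPdist_lt => e e0.
  have C0 : 0 < `|C| + 1 by rewrite ltr_wpDl.
  have r0 : 0 < e / (`|C| + 1) by rewrite divr_gt0.
  apply/nbhs_ballP; exists (e / (`|C| + 1)) => // z; rewrite -ball_normE/= => yz.
  rewrite -linearB (le_lt_trans (LC _))//.
  apply: (@le_lt_trans _ _ ((`|C| + 1) * `|y - z|)).
    by rewrite ler_wpM2r// (le_trans (ler_norm _))// lerDl.
  by rewrite mulrC -ltr_pdivlMr.
have E : f \o shift x = cst (f x) + L +o_ 0 id.
  apply/eqaddoP => e e0; have [r r0 H] := fL e e0.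
  apply/nbhs_ballP; exists r => // h; rewrite -ball_normE/= sub0r normrN => hr.
  have := H h hr; congr (`|_| <= _).
  by rewrite -[RHS]/(f (h + x) - (f x + L h)) opprD addrA (addrC h).
have dE := diff_unique cL E.
by split => //; apply/diff_locallyP; rewrite dE.
Qed.

End frechet.

Lemma addr_sub_sub (V : zmodType) (a b c : V) : a = b + c + (a - b - c).
Proof. by rewrite -[a - b - c]addrA -opprD subrKC. Qed.

Section bounded_bilinear_theory.
Context {R : realType} {d : nat}.
Notation vec := 'cV[R]_d.
Variable B : (R -> vec) -> (R -> vec) -> R.
Hypothesis B_bil : bounded_bilinear B.

Lemma bilinBl f f' g : cbnd f -> cbnd f' -> cbnd g -> B (f - f') g = B f g - B f' g.
Proof.
move=> bf bf' bg; have := bilinl B_bil (-1) bf' bf bg.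
by rewrite scaleN1r addrC mulN1r addrC => ->; rewrite addrC.
Qed.

Lemma bilinBr f g g' : cbnd f -> cbnd g -> cbnd g' -> B f (g - g') = B f g - B f g'.
Proof.
move=> bf bg bg'; have := bilinr B_bil (-1) bf bg' bg.
by rewrite scaleN1r addrC mulN1r addrC => ->; rewrite addrC.
Qed.

Lemma cbnd0 : cbnd (0 : R -> vec).
Proof. by split; [move=> x; exact: cvg_cst|exists 0 => x; rewrite normr0]. Qed.

Lemma bilin0l g : cbnd g -> B 0 g = 0.
Proof. by move=> bg; rewrite -[0 in LHS](subrr (0 : R -> vec)) bilinBl ?subrr//; exact: cbnd0. Qed.

Lemma bilin0r f : cbnd f -> B f 0 = 0.
Proof. by move=> bf; rewrite -[0 in LHS](subrr (0 : R -> vec)) bilinBr ?subrr//; exact: cbnd0. Qed.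

Lemma bilinZl a f g : cbnd f -> cbnd g -> B (a *: f) g = a * B f g.
Proof.
move=> bf bg; have := bilinl B_bil a bf cbnd0 bg.
by rewrite addr0 bilin0l// addr0.
Qed.

Lemma bilinZr a f g : cbnd f -> cbnd g -> B f (a *: g) = a * B f g.
Proof.
move=> bf bg; have := bilinr B_bil a bf bg cbnd0.
by rewrite addr0 bilin0r// addr0.
Qed.

Lemma cbndB (f g : R -> vec) : cbnd f -> cbnd g -> cbnd (f - g).
Proof. by move=> bf bg; apply: cbndD => //; exact: cbndN. Qed.

(** Product rule for a bounded bilinear form evaluated on two curves of
    bounded continuous functions that are differentiable in the supremum norm.
    This is how derivatives are taken under the double integral. *)
Lemma bilin_is_derive (f g : R -> R -> vec) (f' g' : R -> vec) :
  (forall t, cbnd (f t)) -> (forall t, cbnd (g t)) -> cbnd f' -> cbnd g' ->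
  (forall e : R, 0 < e -> exists2 r : R, 0 < r & forall t, `|t| < r -> forall x,
    `|f t x - f 0 x - t *: f' x| <= e * `|t|) ->
  (forall e : R, 0 < e -> exists2 r : R, 0 < r & forall t, `|t| < r -> forall x,
    `|g t x - g 0 x - t *: g' x| <= e * `|t|) ->
  is_derive (0 : R) (1 : R) (fun t => B (f t) (g t)) (B f' (g 0) + B (f 0) g').
Proof.
move=> bf bg bf' bg' df dg; set l := (X in is_derive _ _ _ X).
have [C C0 CB] := bilin_bound B_bil.
have [_ [M0 f0M]] := bf 0; have [_ [N0 g0N]] := bg 0.
have [_ [M' f'M]] := bf'; have [_ [N' g'N]] := bg'.
have M00 : 0 <= M0 := le_trans (normr_ge0 _) (f0M 0).
have N00 : 0 <= N0 := le_trans (normr_ge0 _) (g0N 0).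
have M'0 : 0 <= M' := le_trans (normr_ge0 _) (f'M 0).
have N'0 : 0 <= N' := le_trans (normr_ge0 _) (g'N 0).
have A0 : 0 <= N0 + N' + 1 + M' * (N' + 1) + M0.
  by do ![apply: addr_ge0 => //]; rewrite mulr_ge0// addr_ge0.
pose D := C * (N0 + N' + 1 + M' * (N' + 1) + M0) + 1.
have D0 : 0 < D by rewrite ltr_wpDl// mulr_ge0.
have key (e : R) : 0 < e -> exists2 r : R, 0 < r & forall t, `|t| < r ->
    `|B (f t) (g t) - B (f 0) (g 0) - t * l| <= e * `|t|.
  move=> e0; have [e1 e10 [e11 e1D]] : exists2 e1 : R, 0 < e1 & e1 <= 1 /\ e1 <= e / D.
    exists (Num.min 1 (e / D)); first by rewrite lt_min ltr01 divr_gt0.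
    by split; rewrite ge_min lexx ?orbT.
  have [r1 r10 H1] := df e1 e10; have [r2 r20 H2] := dg e1 e10.
  exists (Num.min e1 (Num.min r1 r2)); first by rewrite !lt_min e10 r10.
  move=> t; rewrite !lt_min => /and3P[te1 tr1 tr2].
  have t1 : `|t| <= 1 by rewrite (le_trans (ltW te1)).
  pose a := f t - f 0 - t *: f'; pose b := g t - g 0 - t *: g'.
  have ba : cbnd a by exact: cbndB (cbndB (bf t) (bf 0)) (cbndZ t bf').
  have bb : cbnd b by exact: cbndB (cbndB (bg t) (bg 0)) (cbndZ t bg').
  have aM x : `|a x| <= e1 * `|t| by exact: H1.
  have bM x : `|b x| <= e1 * `|t| by exact: H2.
  have gtB x : `|g t x| <= N0 + N' + 1.
    have -> : g t x = g 0 x + t *: g' x + b x.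
      exact: addr_sub_sub.
    rewrite (le_trans (ler_normD _ _))// lerD//.
      rewrite (le_trans (ler_normD _ _))// lerD// normrZ -[leRHS]mul1r.
      by rewrite ler_pM.
    by rewrite (le_trans (bM x))// mulr_ile1// ltW.
  have gB x : `|(g t - g 0) x| <= (N' + 1) * `|t|.
    have -> : (g t - g 0) x = t *: g' x + b x.
      by apply/esym; rewrite addrC; exact: subrK.
    rewrite (le_trans (ler_normD _ _))// mulrDl lerD//.
      by rewrite normrZ mulrC ler_wpM2r.
    by rewrite (le_trans (bM x))// ler_wpM2r.
  have -> : B (f t) (g t) - B (f 0) (g 0) - t * l =
      B a (g t) + t * B f' (g t - g 0) + B (f 0) b.
    have bgt : cbnd (g t - g 0) by exact: cbndB.
    have bft : cbnd (f t - f 0) by exact: cbndB.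
    have btf : cbnd (t *: f') by exact: cbndZ.
    have btg : cbnd (t *: g') by exact: cbndZ.
    rewrite /a /b /l !(bilinBl, bilinBr, bilinZl, bilinZr)//.
    ring.
  have K1 := CB _ _ _ _ ba (bg t) aM gtB.
  have K2 := CB _ _ _ _ bf' (cbndB (bg t) (bg 0)) f'M gB.
  have K3 := CB _ _ _ _ (bf 0) bb f0M bM.
  apply: (@le_trans _ _ (e1 * `|t| * (C * (N0 + N' + 1)) +
      e1 * `|t| * (C * (M' * (N' + 1))) + e1 * `|t| * (C * M0))).
    rewrite (le_trans (ler_normD _ _))// lerD//; last first.
      by rewrite (le_trans K3)// le_eqVlt; apply/orP; left; apply/eqP; ring.
    rewrite (le_trans (ler_normD _ _))// lerD//.
      by rewrite (le_trans K1)// le_eqVlt; apply/orP; left; apply/eqP; ring.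
    rewrite normrM; apply: (@le_trans _ _ (e1 * (C * (M' * ((N' + 1) * `|t|))))).
      by rewrite ler_pM// ltW.
    by rewrite le_eqVlt; apply/orP; left; apply/eqP; ring.
  rewrite -!mulrDr mulrAC ler_wpM2r//.
  apply: (@le_trans _ _ (e / D * D)); last by rewrite divfK// gt_eqF.
  rewrite ler_pM//; first by rewrite ltW.
  - exact: mulr_ge0.
  - by rewrite /D lerDl.
have lL : linear (fun t : R => t * l) by move=> c x y; rewrite mulrDl -mulrA.
pose lM := GRing.isLinear.Build _ _ _ _ _ lL.
pose L : {linear R -> R} := HB.pack (fun t : R => t * l) lM.
have [|e e0|dB LE] := @frechet_differentiable_eps R R R (fun t => B (f t) (g t)) 0 L.
- by exists `|l| => h /=; rewrite normrM mulrC.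
- have [r r0 H] := key e e0; exists r => // t tr.
  by rewrite add0r; exact: H.
apply: DeriveDef; first exact: diff_derivable.
by rewrite deriveE// LE /= mul1r.
Qed.

End bounded_bilinear_theory.

(** * The nonlocal part of the Hamiltonian *)

Section C1b_facts.
Context {R : realType} {d : nat}.
Notation vec := 'cV[R]_d.
Implicit Types u v h : C1b R d.

Lemma C1b_Ckb u : Ckb 1 (u : R -> vec).
Proof. exact/asboolP/c1b_prop. Qed.

Lemma Ckb_derivable n (f : R -> vec) x : Ckb n.+1 f -> derivable f x (1 : R).
Proof. by move=> [/(_ 0%N isT x)]; rewrite derive1n0. Qed.

Lemma Ckb_cbnd n (f : R -> vec) : Ckb n.+1 f -> cbnd f.
Proof.
move=> bf; have [_ _ /(_ 0%N isT)] := bf; rewrite derive1n0; split => // x.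
by apply/differentiable_continuous/derivable1_diffP; exact: (Ckb_derivable bf).
Qed.

Lemma Ckb1_derive1 (f : R -> vec) : Ckb 1 f -> cbnd (derive1 f).
Proof. by move=> [_]; rewrite derive1n1 => cf /(_ 1%N isT); rewrite derive1n1. Qed.

Lemma Ckb2_derive1 (f : R -> vec) : Ckb 2 f -> Ckb 1 (derive1 f).
Proof.
move=> [df cf bf]; split.
- move=> j; rewrite ltnS leqn0 => /eqP -> x.
  by rewrite -derive1Sn; exact: (df 1%N isT x).
- by rewrite -derive1Sn; exact: cf.
- by move=> j j1; rewrite -derive1Sn; exact: (bf j.+1 j1).
Qed.

Lemma C1b_cbnd u : cbnd (u : R -> vec).
Proof. exact: (Ckb_cbnd (C1b_Ckb u)). Qed.

Lemma C1b_cbnd1 u : cbnd (derive1 (u : R -> vec)).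
Proof. exact: (Ckb1_derive1 (C1b_Ckb u)). Qed.

Lemma C1b_derivable u x : derivable (u : R -> vec) x (1 : R).
Proof. exact: (Ckb_derivable (C1b_Ckb u)). Qed.

Lemma C1b_derive1D u v x : derive1 (u + v : C1b R d) x = derive1 u x + derive1 v x.
Proof. by rewrite !derive1E -deriveD//; exact: C1b_derivable. Qed.

Lemma C1b_derive1Z (a : R) v x : derive1 (a *: v : C1b R d) x = a *: derive1 v x.
Proof. by rewrite !derive1E -deriveZ//; exact: C1b_derivable. Qed.

Lemma cbnd_sup (f : R -> vec) x : cbnd f -> `|f x| <= sup_norm f.
Proof.
move=> [_ [M fM]]; apply: ub_le_sup; last by exists x.
by exists M => _ [y _ <-].
Qed.

Lemma C1b_normE u : `|u| = sup_norm u + sup_norm (derive1 u).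
Proof. by []. Qed.

Lemma C1b_le_norm u x : `|u x| <= `|u|.
Proof.
rewrite C1b_normE (le_trans (cbnd_sup x (C1b_cbnd u)))// lerDl.
by rewrite (le_trans _ (cbnd_sup 0 (C1b_cbnd1 u))).
Qed.

Lemma C1b_le_norm1 u x : `|derive1 u x| <= `|u|.
Proof.
rewrite C1b_normE (le_trans (cbnd_sup x (C1b_cbnd1 u)))// lerDr.
by rewrite (le_trans _ (cbnd_sup 0 (C1b_cbnd u))).
Qed.

End C1b_facts.

(** Polarisation of f |-> - C f f / 2 + (P f f' - P f' f) / 2 around f.
    The terms of first order that contain the derivative g' - f' of the
    increment are traded, by integration by parts, for terms that contain only
    g - f itself. *)
Lemma antisym_increment (R : realType) (d : nat)
    (P C : (R -> 'cV[R]_d) -> (R -> 'cV[R]_d) -> R) (f f' g g' : R -> 'cV[R]_d) :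
  bounded_bilinear P -> bounded_bilinear C ->
  cbnd f -> cbnd f' -> cbnd g -> cbnd g' ->
  P f g' + P f' g - P g f' - P g' f = C f g - C g f ->
  - (2^-1 * C g g) + 2^-1 * (P g g' - P g' g)
  - (- (2^-1 * C f f) + 2^-1 * (P f f' - P f' f)) =
  - C (g - f) f + P (g - f) f' - P f' (g - f) +
  (- (2^-1 * C (g - f) (g - f)) +
   2^-1 * (P (g - f) (g' - f') - P (g' - f') (g - f))).
Proof.
move=> Pbb Cbb bf bf' bg bg' ibp.
have bgf := cbndB bg bf; have bgf' := cbndB bg' bf'.
rewrite !(bilinBl Pbb, bilinBr Pbb, bilinBl Cbb, bilinBr Cbb)//; lra.
Qed.

Section nonlocal.
Context {R : realType} {d : nat}.
Notation vec := 'cV[R]_d.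
Variables (K : R -> 'M[R]_d) (S : vec -> vec).
Hypothesis K_even : forall r, K (- r) = K r.
Hypothesis K_sym : forall r, (K r)^T = K r.
Hypothesis K_L1 : kernel_L1 K.
Hypothesis K_moment : kernel_moment K.
Hypothesis S_C2 : Ck 2 S.
Implicit Types u v w h : C1b R d.

Local Notation P := (quadrant_form K).
Local Notation C := (boundary_form K).
Let Pbb := quadrant_form_bilinear K_even K_L1 K_moment.
Let Cbb := boundary_form_bilinear K_even K_L1.

(** The linearisation DS(u) v of the superposition operator u |-> S o u.  With
    v = u' it is the derivative of S o u in x. *)
Definition linearized (u v : R -> vec) : R -> vec := fun x => Jac S (u x) *m v x.
Local Notation ps u := (S \o (u : R -> vec)).
Local Notation ps' u := (linearized u (derive1 u)).

Lemma cbnd_ps u : cbnd (ps u).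
Proof. exact: (cbnd_S S_C2 (C1b_cbnd u)). Qed.

Lemma cbnd_ps' u : cbnd (ps' u).
Proof. exact: (cbnd_Jac S_C2 (C1b_cbnd u) (C1b_cbnd1 u)). Qed.

Lemma cbnd_linearized u v : cbnd (linearized u v).
Proof. exact: (cbnd_Jac S_C2 (C1b_cbnd u) (C1b_cbnd v)). Qed.

Lemma is_derive_ps u (x : R) : is_derive x (1 : R) (ps u) (ps' u x).
Proof. exact: (is_derive_comp_Jac S_C2 (@C1b_derivable _ _ u x)). Qed.

(** With h small in C^1: S(u+h) - S(u) agrees with its linearisation up to
    o(|h|) in the supremum norm, while for its x-derivative mere smallness is
    enough, because that derivative occurs only in the quadratic remainder. *)
Lemma increment_bounds u : exists2 c : R, 0 <= c & forall e : R, 0 < e ->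
  exists2 r : R, 0 < r & forall h, `|h| < r -> forall x,
  [/\ `|(ps (u + h) - ps u - linearized u h) x| <= e * `|h|,
      `|(ps (u + h) - ps u) x| <= c * `|h| &
      `|(ps' (u + h) - ps' u) x| <= e].
Proof.
have [c c0 cH] := Jac_bound S_C2 `|u|.
have c1 : 0 < c + 1 by rewrite ltr_wpDl.
have u1 : 0 < `|u| + 1 by rewrite ltr_wpDl.
exists (c + 1) => [|e e0]; first exact: ltW.
have [e1 e10 [e11 e1e]] : exists2 e1 : R, 0 < e1 & e1 <= 1 /\ e1 <= e.
  exists (Num.min 1 e); first by rewrite lt_min ltr01.
  by split; rewrite ge_min lexx ?orbT.
have e20 : 0 < e / 2 / (`|u| + 1) by rewrite !divr_gt0.
have e30 : 0 < e / 2 / (c + 1) by rewrite !divr_gt0.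
have [r1 r10 H1] := uniform_diff_C2 S_C2 `|u| e10.
have [r2 r20 H2] := Jac_uniform_cont S_C2 `|u| e20.
exists (Num.min (Num.min 1 (e / 2 / (c + 1))) (Num.min r1 r2)).
  by rewrite !lt_min ltr01 e30 r10.
move=> h; rewrite !lt_min => /andP[/andP[h1 he] /andP[hr1 hr2]] x.
have hx := C1b_le_norm h x.
have A1 : `|(ps (u + h) - ps u - linearized u h) x| <= e1 * `|h|.
  rewrite (le_trans (H1 _ (C1b_le_norm u x) _ (le_trans hx (ltW hr1))))//.
  by rewrite ler_wpM2l// ltW.
split.
- by rewrite (le_trans A1)// ler_wpM2r.
- have -> : (ps (u + h) - ps u) x = (ps (u + h) - ps u - linearized u h) x + linearized u h x.
    by rewrite -[RHS]/((ps (u + h) - ps u) x - linearized u h x + linearized u h x) subrK.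
  rewrite (le_trans (ler_normD _ _))// addrC mulrDl lerD//.
    by rewrite (le_trans (cH _ (C1b_le_norm u x) _))// ler_wpM2l.
  by rewrite (le_trans A1)// ler_wpM2r.
have -> : (ps' (u + h) - ps' u) x =
    (Jac S (u x + h x) - Jac S (u x)) *m (derive1 u x + derive1 h x) +
    Jac S (u x) *m derive1 h x.
  rewrite -[LHS]/(Jac S (u x + h x) *m derive1 (u + h : C1b R d) x -
    Jac S (u x) *m derive1 u x) C1b_derive1D mulmxBl -addrA; congr (_ + _).
  by rewrite mulmxDr opprD subrK.
rewrite (splitr e) (le_trans (ler_normD _ _))// lerD//.
  rewrite (le_trans (H2 _ (C1b_le_norm u x) _ (le_trans hx (ltW hr2)) _))//.
  rewrite -[leRHS](divfK (lt0r_neq0 u1)) ler_wpM2l ?(ltW e20)//.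
  apply: (le_trans (ler_normD _ _)); apply: lerD; first exact: C1b_le_norm1.
  exact: (le_trans (C1b_le_norm1 h x) (ltW h1)).
apply: (le_trans (cH _ (C1b_le_norm u x) _)).
rewrite -[leRHS](divfK (lt0r_neq0 c1)) [leRHS]mulrC; apply: ler_pM => //.
  by rewrite lerDl.
exact: (le_trans (C1b_le_norm1 h x) (ltW he)).
Qed.

Definition nonlocal (w : R -> vec) : R :=
  - (2^-1 * C (ps w) (ps w)) + 2^-1 * (P (ps w) (ps' w) - P (ps' w) (ps w)).

(** The derivative of the nonlocal energy in the variable S o u, after
    integration by parts: a functional of g alone, not of g', so that it is
    bounded in the supremum norm. *)
Definition nonlocal_der (w g : R -> vec) : R :=
  - C g (ps w) + P g (ps' w) - P (ps' w) g.

Lemma nonlocal_increment u w :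
  nonlocal w - nonlocal u = nonlocal_der u (ps w - ps u) +
  (- (2^-1 * C (ps w - ps u) (ps w - ps u)) +
   2^-1 * (P (ps w - ps u) (ps' w - ps' u) - P (ps' w - ps' u) (ps w - ps u))).
Proof.
have ibp := quadrant_form_antisym K_even K_sym K_L1 K_moment (is_derive_ps u) (is_derive_ps w)
  (cbnd_ps u) (cbnd_ps' u) (cbnd_ps w) (cbnd_ps' w).
exact: (antisym_increment Pbb Cbb (cbnd_ps u) (cbnd_ps' u) (cbnd_ps w) (cbnd_ps' w) ibp).
Qed.

Lemma nonlocal_der_lin u a g g' : cbnd g -> cbnd g' ->
  nonlocal_der u (a *: g + g') = a * nonlocal_der u g + nonlocal_der u g'.
Proof.
move=> bg bg'; have bs := cbnd_ps u; have bs' := cbnd_ps' u.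
rewrite /nonlocal_der (bilinl Cbb a bg bg' bs) (bilinl Pbb a bg bg' bs') (bilinr Pbb a bs' bg bg').
ring.
Qed.

Lemma nonlocal_der_bound u : exists2 c : R, 0 <= c & forall g M, cbnd g ->
  (forall x, `|g x| <= M) -> `|nonlocal_der u g| <= c * M.
Proof.
have [c1 c10 H1] := bilin_bound Cbb; have [c2 c20 H2] := bilin_bound Pbb.
have [_ [M sM]] := cbnd_ps u; have [_ [M' s'M]] := cbnd_ps' u.
have M0 : 0 <= M := le_trans (normr_ge0 _) (sM 0).
have M'0 : 0 <= M' := le_trans (normr_ge0 _) (s'M 0).
exists (c1 * M + c2 * M' + c2 * M') => [|g N bg gN].
  by rewrite !addr_ge0// mulr_ge0.
rewrite /nonlocal_der (le_trans (ler_normB _ _))// (le_trans (lerD (ler_normD _ _) (lexx _)))//.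
rewrite normrN !mulrDl !lerD//.
- by rewrite (le_trans (H1 _ _ _ _ bg (cbnd_ps u) gN sM))// mulrCA mulrC.
- by rewrite (le_trans (H2 _ _ _ _ bg (cbnd_ps' u) gN s'M))// mulrCA mulrC.
- by rewrite (le_trans (H2 _ _ _ _ (cbnd_ps' u) bg s'M gN))// mulrA.
Qed.

(** Being bounded in the supremum norm, nonlocal_der u maps the o(|h|) remainder
    of S o u to o(|h|); the quadratic remainder is O(|h|) times a small
    derivative. *)
Lemma nonlocal_diff u : differentiable (fun w : C1b R d => nonlocal w) u /\
  forall v, 'd (fun w : C1b R d => nonlocal w) u v = nonlocal_der u (linearized u v).
Proof.
have bs := cbnd_ps u; have bs' := cbnd_ps' u.
have lL : linear (fun v : C1b R d => nonlocal_der u (linearized u v)).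
  move=> a v w; rewrite -[RHS]/(a * nonlocal_der u (linearized u v) + nonlocal_der u (linearized u w)).
  rewrite -(nonlocal_der_lin u a (cbnd_linearized u v) (cbnd_linearized u w)); congr (nonlocal_der u _).
  apply/funext => x.
  rewrite -[RHS]/(a *: (Jac S (u x) *m v x) + Jac S (u x) *m w x).
  by rewrite scalemxAr -mulmxDr.
pose lM := GRing.isLinear.Build _ _ _ _ _ lL.
pose L : {linear C1b R d -> R} := HB.pack (fun v : C1b R d => nonlocal_der u (linearized u v)) lM.
have [cD cD0 HD] := nonlocal_der_bound u.
have [cJ cJ0 HJ] := Jac_bound S_C2 `|u|.
have [c1 c10 H1] := bilin_bound Cbb; have [c2 c20 H2] := bilin_bound Pbb.
have [c c0 Hc] := increment_bounds u.
have [||dN LE] := @frechet_differentiable_eps R (C1b R d) R (fun w => nonlocal w) u L.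
- exists (cD * cJ) => h; rewrite -mulrA; apply: HD; first exact: cbnd_linearized.
  move=> x; rewrite (le_trans (HJ _ (C1b_le_norm u x) _))//.
  by rewrite ler_wpM2l// C1b_le_norm.
- move=> e e0.
  have D0 : 0 <= cD + 2^-1 * (c1 * (c * c)) + c2 * c.
    by rewrite !addr_ge0// !mulr_ge0.
  pose D := cD + 2^-1 * (c1 * (c * c)) + c2 * c + 1.
  have D1 : 0 < D by rewrite ltr_wpDl.
  have e10 : 0 < e / D by rewrite divr_gt0.
  have [r r0 Hr] := Hc _ e10.
  exists (Num.min r (e / D)); first by rewrite lt_min r0.
  move=> h; rewrite lt_min => /andP[hr he].
  have [a1 a2 a3] : [/\ forall x, `|(ps (u + h) - ps u - linearized u h) x| <= e / D * `|h|,
      forall x, `|(ps (u + h) - ps u) x| <= c * `|h| &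
      forall x, `|(ps' (u + h) - ps' u) x| <= e / D].
    by split => x; have [] := Hr h hr x.
  have b1 := cbnd_ps (u + h); have b2 := cbnd_ps' (u + h).
  have b3 := cbndB b1 bs; have b4 := cbndB b2 bs'.
  have b5 := cbnd_linearized u h; have b6 := cbndB b3 b5.
  have E : nonlocal (u + h : C1b R d) - nonlocal u - nonlocal_der u (linearized u h) =
    nonlocal_der u (ps (u + h) - ps u - linearized u h) +
    (- (2^-1 * C (ps (u + h) - ps u) (ps (u + h) - ps u)) +
     2^-1 * (P (ps (u + h) - ps u) (ps' (u + h) - ps' u)
             - P (ps' (u + h) - ps' u) (ps (u + h) - ps u))).
    rewrite nonlocal_increment.
    have -> : ps (u + h) - ps u - linearized u h = (-1) *: linearized u h + (ps (u + h) - ps u).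
      by rewrite scaleN1r addrC.
    by rewrite (nonlocal_der_lin _ _ b5 b3) mulN1r addrAC [X in X + _]addrC.
  have K1 := HD _ _ b6 a1.
  have K2 := H1 _ _ _ _ b3 b3 a2 a2.
  have K3 := H2 _ _ _ _ b3 b4 a2 a3.
  have K4 := H2 _ _ _ _ b4 b3 a3 a2.
  rewrite [L h]/(nonlocal_der u (linearized u h)) E.
  move: K1 K2 K3 K4; set x1 := nonlocal_der _ _; set x2 := C _ _; set x3 := P _ _; set x4 := P _ _.
  move=> K1 K2 K3 K4.
  have n0 : 0 <= `|h| := normr_ge0 h.
  have eD : e = e / D * D by rewrite divfK// lt0r_neq0.
  move: K1 K2 K3 K4 eD he e10 n0; rewrite /D.
  move: `|h| (e / _) => n m K1 K2 K3 K4 eD nm m0 n0.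
  have ccn : c1 * (c * n * (c * n)) <= c1 * (c * c) * (m * n).
    have -> : c1 * (c * n * (c * n)) = c1 * (c * c) * (n * n) by ring.
    by rewrite ler_wpM2l ?mulr_ge0// ler_wpM2r// ltW.
  have mn0 : 0 <= m * n by rewrite mulr_ge0// ltW.
  rewrite eD; move: K1 K2 K3 K4; rewrite !ler_norml.
  move=> /andP[? ?] /andP[? ?] /andP[? ?] /andP[? ?]; apply/andP; split; lra.
split => // v; by rewrite LE.
Qed.

End nonlocal.

(** * The local part of the Hamiltonian *)

Section dotv.
Context {R : realType} {d : nat}.
Notation vec := 'cV[R]_d.

Lemma dotvDl (a b c : vec) : dotv (a + b) c = dotv a c + dotv b c.
Proof. by rewrite /dotv -big_split/=; apply: eq_bigr => i _; rewrite mxE mulrDl. Qed.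

Lemma dotvNl (a b : vec) : dotv (- a) b = - dotv a b.
Proof. by rewrite /dotv -sumrN; apply: eq_bigr => i _; rewrite mxE mulNr. Qed.

Lemma dotvC (a b : vec) : dotv a b = dotv b a.
Proof. by apply: eq_bigr => i _; rewrite mulrC. Qed.

Lemma dotv_trmx (A : 'M[R]_d) (a b : vec) : dotv a (A^T *m b) = dotv (A *m a) b.
Proof.
rewrite dotv_mulmx exchange_big/=; apply: eq_bigr => i _; rewrite mxE mulr_suml.
by apply: eq_bigr => j _; rewrite mxE mulrA.
Qed.

End dotv.

Section lagrangian.
Context {R : realType} {d : nat}.
Notation vec := 'cV[R]_d.
Notation ej j := (delta_mx j 0 : vec).
Variable E : vec * vec -> R.
Hypothesis E_C2 : Ck 2 E.

Lemma lagrangian_differentiable q : differentiable E q. Proof. by have [] := E_C2. Qed.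

(** The canonical momentum of the i-th coordinate.  As a directional derivative
    of the C^2 function E on the product space it is C^1 by definition. *)
Definition momentum (i : 'I_d) : vec * vec -> R := 'D_((0 : vec, ej i)) E.

Lemma momentum_diff i q : differentiable (momentum i) q.
Proof. by have [_ /(_ (0 : vec, ej i))[]] := E_C2. Qed.

Lemma grad_vE q i : grad_v E q i 0 = momentum i q.
Proof.
case: q => a b; rewrite mxE /momentum /= -deriveE; last first.
  apply: (@differentiable_comp _ _ _ _ (fun y : vec => (a, y)) E); last exact: lagrangian_differentiable.
  by apply: (@differentiable_pair _ _ _ _ (cst a) id); [exact: differentiable_cst|exact: ex_diff].
have q1 : (fun h : R => h^-1 *: (((fun y : vec => E (a, y)) \o shift b) (h *: ej i)
      - E (a, b))) =
    (fun h : R => h^-1 *: ((E \o shift (a, b)) (h *: (0 : vec, ej i)) - E (a, b))).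
  apply/funext => h /=; congr (_ *: (E _ - _)).
  by rewrite -[RHS]/(h *: 0 + a, h *: ej i + b) scaler0 add0r.
by rewrite /derive q1.
Qed.

Lemma grad_uE q i : grad_u E q i 0 = 'd E q (ej i, 0).
Proof.
case: q => a b; rewrite mxE /= -!deriveE; [|exact: lagrangian_differentiable|].
  have q1 : (fun h : R => h^-1 *: (((fun y : vec => E (y, b)) \o shift a) (h *: ej i)
        - E (a, b))) =
      (fun h : R => h^-1 *: ((E \o shift (a, b)) (h *: (ej i, 0 : vec)) - E (a, b))).
    apply/funext => h /=; congr (_ *: (E _ - _)).
    by rewrite -[RHS]/(h *: ej i + a, h *: 0 + b) scaler0 add0r.
  by rewrite /derive q1.
apply: (@differentiable_comp _ _ _ _ (fun y : vec => (y, b)) E); last exact: lagrangian_differentiable.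
by apply: (@differentiable_pair _ _ _ _ id (cst b)); [exact: ex_diff|exact: differentiable_cst].
Qed.

Lemma diff_E q (a b : vec) :
  'd E q (a, b) = dotv (grad_u E q) a + \sum_(i < d) momentum i q * b i 0.
Proof.
have sumE (c : vec) : c = \sum_(j < d) c j 0 *: ej j.
  by rewrite {1}[c]matrix_sum_delta; apply: eq_bigr => j _; rewrite big_ord1.
have fstE (s : 'I_d -> vec) :
    \sum_(i < d) (s i, 0 : vec) = (\sum_(i < d) s i, 0 : vec).
  by elim/big_ind2 : _ => // x1 x2 y1 y2 -> ->; congr (_, _); rewrite /= addr0.
have sndE (s : 'I_d -> vec) :
    \sum_(i < d) (0 : vec, s i) = (0 : vec, \sum_(i < d) s i).
  by elim/big_ind2 : _ => // x1 x2 y1 y2 -> ->; congr (_, _); rewrite /= addr0.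
have -> : (a, b) = \sum_(i < d) a i 0 *: (ej i, 0 : vec) +
    \sum_(i < d) b i 0 *: (0 : vec, ej i).
  transitivity ((a, 0 : vec) + (0 : vec, b)).
    by congr (_, _); rewrite /= ?addr0 ?add0r.
  rewrite {1}[a]sumE {1}[b]sumE -fstE -sndE; congr (_ + _).
    by apply: eq_bigr => i _; congr (_, _); rewrite /= scaler0.
  by apply: eq_bigr => i _; congr (_, _); rewrite /= scaler0.
rewrite linearD !linear_sum/= /dotv; congr (_ + _); apply: eq_bigr => i _.
  by rewrite linearZ/= grad_uE mulrC.
have -> : momentum i q = 'd E q (0 : vec, ej i) by apply: deriveE; exact: lagrangian_differentiable.
by rewrite linearZ mulrC.
Qed.

Definition local_energy (q : vec * vec) : R := E q - dotv (grad_v E q) q.2.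

Lemma snd_coord_diff (i : 'I_d) (q : vec * vec) :
  differentiable (fun q : vec * vec => q.2 i 0 : R) q /\
  'd (fun q : vec * vec => q.2 i 0 : R) q = (fun w => w.2 i 0) :> (vec * vec -> R).
Proof.
have lL : linear (fun q : vec * vec => q.2 i 0 : R) by move=> a x y; rewrite !mxE.
pose lM := GRing.isLinear.Build _ _ _ _ _ lL.
pose L : {linear (vec * vec)%type -> R} := HB.pack (fun q : vec * vec => q.2 i 0 : R) lM.
have cL : continuous L.
  move=> p; apply: (@continuous_comp _ _ _ snd (fun N : vec => N i 0)).
    exact: cvg_snd.
  exact: coord_continuous.
split; last exact: (diff_lin q cL).
by apply: (@linear_differentiable _ _ _ L); exact: cL.
Qed.

Lemma snd_coord_is_derive (i : 'I_d) (q w : vec * vec) :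
  is_derive q w (fun q : vec * vec => q.2 i 0 : R) (w.2 i 0).
Proof.
have [dL LE] := snd_coord_diff i q.
by apply: DeriveDef; [exact: diff_derivable|rewrite deriveE// LE].
Qed.

Lemma local_energy_differentiable q : differentiable local_energy q.
Proof.
have -> : local_energy = E - \sum_(i < d) (momentum i * (fun q : vec * vec => q.2 i 0 : R)).
  apply/funext => p; rewrite /local_energy /dotv; congr (_ - _).
  by rewrite fct_sumE; apply: eq_bigr => i _; rewrite grad_vE.
apply: differentiableB; first exact: lagrangian_differentiable.
apply: differentiable_sum => i; apply: differentiableM; first exact: momentum_diff.
by have [] := snd_coord_diff i q.
Qed.

(** The derivative in the velocity of E cancels against the derivative of the
    velocity in grad_v E . u'; the velocity component of w survives only
    through the derivative of the momenta. *)
Lemma diff_local_energy q w : 'd local_energy q w = dotv (grad_u E q) w.1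
  - \sum_(i < d) q.2 i 0 * 'd (momentum i) q w.
Proof.
have lE : local_energy = E - \sum_(i < d) (momentum i * (fun q : vec * vec => q.2 i 0 : R)).
  apply/funext => p; rewrite /local_energy /dotv; congr (_ - _).
  by rewrite fct_sumE; apply: eq_bigr => i _; rewrite grad_vE.
rewrite -deriveE; last exact: local_energy_differentiable.
have h1 : is_derive q w E ('d E q w).
  by rewrite -deriveE; [apply/derivableP/diff_derivable|]; exact: lagrangian_differentiable.
have h2 i : is_derive q w (momentum i) ('d (momentum i) q w).
  by rewrite -deriveE; [apply/derivableP/diff_derivable|]; exact: momentum_diff.
have h3 i := snd_coord_is_derive i q w.
have H : is_derive q w local_energy ('d E q w -
   \sum_(i < d) (momentum i q *: w.2 i 0 + q.2 i 0 *: 'd (momentum i) q w)).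
  rewrite lE; apply: is_deriveB; apply: is_derive_sum => i; exact: is_deriveM.
rewrite derive_val; case: w {h1 h2 h3 H} => a b; rewrite diff_E big_split/=.
by rewrite opprD addrA addrK.
Qed.

End lagrangian.

(** * The one-form and its exterior derivative *)

Section one_form.
Context {R : realType} {d : nat}.
Notation vec := 'cV[R]_d.
Variables (K : R -> 'M[R]_d) (S : vec -> vec) (E : vec * vec -> R).
Hypothesis K_even : forall r, K (- r) = K r.
Hypothesis K_sym : forall r, (K r)^T = K r.
Hypothesis K_L1 : kernel_L1 K.
Hypothesis K_moment : kernel_moment K.
Hypothesis S_C2 : Ck 2 S.
Hypothesis E_C2 : Ck 2 E.

Local Notation P := (quadrant_form K).
Let Pbb := quadrant_form_bilinear K_even K_L1 K_moment.

Lemma lambda_nE (u v : R -> vec) : lambda_n K S u v = P (linearized S u v) (S \o u).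
Proof. by apply: eq_Rintegral => p _; rewrite dotv_trmx. Qed.

Lemma lambda_locE (u v : R -> vec) :
  lambda_loc E u v = - \sum_(i < d) momentum E i (jet u 0) * v 0 i 0.
Proof.
by rewrite /lambda_loc /dotv; congr (- _); apply: eq_bigr => i _; rewrite grad_vE.
Qed.

Lemma omega_nE (u v w : R -> vec) : cbnd u -> cbnd v -> cbnd w ->
  omega_n K S u v w =
  P (linearized S u v) (linearized S u w) - P (linearized S u w) (linearized S u v).
Proof.
move=> bu bv bw; have bJv := cbnd_Jac S_C2 bu bv; have bJw := cbnd_Jac S_C2 bu bw.
rewrite /quadrant_form /intQ -RintegralB//; last 3 first.
- exact: measurable_quadrant.
- exact: (quadrant_form_integrable K_even K_L1 K_moment bJv bJw).
- exact: (quadrant_form_integrable K_even K_L1 K_moment bJw bJv).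
have A x y (a b : vec) : dotv a (Axy K S u x y *m b) =
    dotv (Jac S (u x) *m a) (K (x - y) *m (Jac S (u y) *m b)).
  by rewrite /Axy -!mulmxA dotv_trmx.
apply: eq_Rintegral => p _; rewrite A A.
by rewrite -[in X in _ - X](opprB p.1 p.2) K_even (dotv_kernel_sym K_sym (Jac S (u p.2) *m _)).
Qed.

Lemma jet_line (u b : R -> vec) (t : R) :
  derivable u 0 (1 : R) -> derivable b 0 (1 : R) ->
  jet (u + t *: b) 0 = jet u 0 + t *: jet b 0.
Proof.
move=> du db; have dtb : derivable (t *: b) 0 (1 : R) by exact: derivableZ.
rewrite /jet; have -> : derive1 (u + t *: b) 0 = derive1 u 0 + t *: derive1 b 0.
  by rewrite !derive1E (deriveD du dtb) (deriveZ _ db).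
by [].
Qed.

Lemma cbnd_line (u b : R -> vec) (t : R) : cbnd u -> cbnd b -> cbnd (u + t *: b).
Proof. by move=> bu bb; apply: cbndD => //; exact: cbndZ. Qed.

Lemma linearized_line_diff (u a b : R -> vec) (e : R) : cbnd u -> cbnd a -> cbnd b ->
  0 < e -> exists2 r : R, 0 < r & forall t, `|t| < r -> forall x,
  `|linearized S (u + t *: b) a x - linearized S u a x - t *: hess S (u x) (b x) (a x)|
    <= e * `|t|.
Proof.
move=> [_ [M uM]] [_ [N aN]] [_ [L bL]] e0.
have N0 : 0 <= N := le_trans (normr_ge0 _) (aN 0).
have L0 : 0 <= L := le_trans (normr_ge0 _) (bL 0).
have D0 : 0 < (L + 1) * (N + 1) by rewrite mulr_gt0// ltr_wpDl.
have e10 : 0 < e / ((L + 1) * (N + 1)) by rewrite divr_gt0.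
have [r r0 H] := Jac_uniform_diff S_C2 M e10.
have L1 : 0 < L + 1 by rewrite ltr_wpDl.
exists (r / (L + 1)) => [|t tr x]; first by rewrite divr_gt0.
have tb : `|t *: b x| <= `|t| * (L + 1).
  by rewrite normrZ ler_wpM2l// (le_trans (bL x))// lerDl.
have tbr : `|t *: b x| <= r.
  by rewrite (le_trans tb)// -ler_pdivlMr// ltW.
have hZ : hess S (u x) (t *: b x) (a x) = t *: hess S (u x) (b x) (a x).
  apply/colP => i; rewrite [RHS]mxE !hessE// mulr_sumr; apply: eq_bigr => j _.
  by rewrite mulr_sumr; apply: eq_bigr => l _; rewrite mxE !mulrA.
have := H _ (uM x) _ tbr (a x); rewrite hZ mulmxBl => H1.
apply: (le_trans H1).
apply: (@le_trans _ _ (e / ((L + 1) * (N + 1)) * (`|t| * (L + 1)) * (N + 1))).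
  apply: ler_pM => //; first by rewrite mulr_ge0// ltW.
    by rewrite ler_wpM2l// ltW.
  by rewrite (le_trans (aN x))// lerDl.
have -> : e / ((L + 1) * (N + 1)) * (`|t| * (L + 1)) * (N + 1) =
    e / ((L + 1) * (N + 1)) * ((L + 1) * (N + 1)) * `|t| by ring.
by rewrite divfK// lt0r_neq0.
Qed.

Lemma S_line_diff (u b : R -> vec) (e : R) : cbnd u -> cbnd b ->
  0 < e -> exists2 r : R, 0 < r & forall t, `|t| < r -> forall x,
  `|(S \o (u + t *: b)) x - (S \o u) x - t *: linearized S u b x| <= e * `|t|.
Proof.
move=> [_ [M uM]] [_ [L bL]] e0.
have L0 : 0 <= L := le_trans (normr_ge0 _) (bL 0).
have L1 : 0 < L + 1 by rewrite ltr_wpDl.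
have e10 : 0 < e / (L + 1) by rewrite divr_gt0.
have [r r0 H] := uniform_diff_C2 S_C2 M e10.
exists (r / (L + 1)) => [|t tr x]; first by rewrite divr_gt0.
have tb : `|t *: b x| <= `|t| * (L + 1).
  by rewrite normrZ ler_wpM2l// (le_trans (bL x))// lerDl.
have tbr : `|t *: b x| <= r.
  by rewrite (le_trans tb)// -ler_pdivlMr// ltW.
have := H _ (uM x) _ tbr; rewrite -scalemxAr => H1.
apply: (le_trans H1).
apply: (@le_trans _ _ (e / (L + 1) * (`|t| * (L + 1)))).
  by rewrite ler_wpM2l// ltW.
have -> : e / (L + 1) * (`|t| * (L + 1)) = e / (L + 1) * (L + 1) * `|t| by ring.
by rewrite divfK// lt0r_neq0.
Qed.

(** The first term, a second derivative of S, is symmetric in a and b by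
    Schwarz's theorem and disappears from the exterior derivative. *)
Lemma DlambdaE (u a b : R -> vec) : cbnd u -> cbnd a -> cbnd b ->
  derivable u 0 (1 : R) -> derivable b 0 (1 : R) ->
  Dlambda K S E u a b =
  P (fun x => hess S (u x) (b x) (a x)) (S \o u) + P (linearized S u a) (linearized S u b)
  - \sum_(i < d) 'd (momentum E i) (jet u 0) (jet b 0) * a 0 i 0.
Proof.
move=> bu ba bb du db; rewrite /Dlambda derive1E.
pose f (t : R) : R -> vec := linearized S (u + t *: b) a.
pose g (t : R) : R -> vec := S \o (u + t *: b).
have f0 : f 0 = linearized S u a by rewrite /f scale0r addr0.
have g0 : g 0 = S \o u by rewrite /g scale0r addr0.
have bf t : cbnd (f t) by exact: (cbnd_Jac S_C2 (cbnd_line t bu bb) ba).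
have bg t : cbnd (g t) by exact: (cbnd_S S_C2 (cbnd_line t bu bb)).
have bh := cbnd_hess S_C2 bu bb ba; have bp := cbnd_Jac S_C2 bu bb.
have H1 := bilin_is_derive Pbb bf bg bh bp.
have {}H1 : is_derive (0 : R) (1 : R) (fun t => P (f t) (g t))
    (P (fun x => hess S (u x) (b x) (a x)) (S \o u) + P (linearized S u a) (linearized S u b)).
  rewrite -f0 -g0; apply: H1 => e e0; rewrite ?f0 ?g0.
    exact: linearized_line_diff.
  exact: S_line_diff.
have H2 i : is_derive (0 : R) (1 : R) (fun t => momentum E i (jet u 0 + t *: jet b 0))
    ('d (momentum E i) (jet u 0) (jet b 0)).
  have dm : differentiable (momentum E i) (jet u 0) by exact: momentum_diff.
  rewrite -(deriveE _ dm).
  have := @is_derive_line R _ _ (momentum E i) (jet u 0) (jet b 0) 0.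
  rewrite scale0r addr0; apply; exact: (diff_derivable dm).
have -> : (fun t : R => lambda K S E (u + t *: b) a) =
    (fun t => P (f t) (g t)) -
    \sum_(i < d) ((fun t => momentum E i (jet u 0 + t *: jet b 0)) * (cst (a 0 i 0 : R))).
  apply/funext => t; rewrite /lambda lambda_nE lambda_locE fct_sumE.
  by congr (_ - _); apply: eq_bigr => i _; rewrite jet_line.
have H3 : is_derive (0 : R) (1 : R)
    (\sum_(i < d) ((fun t => momentum E i (jet u 0 + t *: jet b 0)) * (cst (a 0 i 0 : R))))
    (\sum_(i < d) 'd (momentum E i) (jet u 0) (jet b 0) * a 0 i 0).
  apply: is_derive_sum => i; have h := H2 i.
  by apply: is_derive_eq; rewrite scaler0 add0r mulrC.
by rewrite derive_val.
Qed.

End one_form.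

(** * The Hamiltonian identity *)

Section jet0.
Context {R : realType} {d : nat}.
Notation vec := 'cV[R]_d.

Lemma jet0_diff (u : C1b R d) :
  differentiable (fun w : C1b R d => jet w 0) u /\
  'd (fun w : C1b R d => jet w 0) u = (fun w : C1b R d => jet w 0) :> (C1b R d -> _).
Proof.
have jD (w v : C1b R d) : jet (w + v : C1b R d) 0 = jet w 0 + jet v 0.
  by rewrite /jet C1b_derive1D.
have jZ a (w : C1b R d) : jet (a *: w : C1b R d) 0 = a *: jet w 0.
  by rewrite /jet C1b_derive1Z.
have lL : linear (fun w : C1b R d => jet w 0).
  by move=> a w v; rewrite jD jZ.
pose lM := GRing.isLinear.Build _ _ _ _ _ lL.
pose L : {linear C1b R d -> (vec * vec)%type} := HB.pack (fun w : C1b R d => jet w 0) lM.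
have [||dL LE] := @frechet_differentiable_eps R (C1b R d) (vec * vec)%type (fun w => jet w 0) u L.
- exists 1 => h; rewrite mul1r [leLHS]prod_normE ge_max; apply/andP; split.
    exact: C1b_le_norm.
  exact: C1b_le_norm1.
- move=> e e0; exists 1 => // h _.
  have -> : jet (u + h : C1b R d) 0 - jet u 0 - L h = 0.
    by rewrite jD (addrAC (jet u 0)) subrr add0r; exact: subrr.
  by rewrite normr0 mulr_ge0// ltW.
by [].
Qed.

End jet0.

Lemma HamE (R : realType) (d : nat) (K : R -> 'M[R]_d) (S : 'cV[R]_d -> 'cV[R]_d)
    (E : 'cV[R]_d * 'cV[R]_d -> R) (w : C1b R d) :
  (forall r, K (- r) = K r) -> (forall r, (K r)^T = K r) ->
  kernel_L1 K -> kernel_moment K -> Ck 2 S ->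
  Ham K S E w = - local_energy E (jet w 0) + nonlocal K S w.
Proof.
move=> K_even K_sym K_L1 K_moment S_C2.
have bs := cbnd_ps S_C2 w; have bs' := cbnd_ps' S_C2 w.
rewrite /Ham /nonlocal /local_energy.
have -> : intQ (fun x y =>
      dotv (S (w x)) (K (x - y) *m (Jac S (w y) *m (derive1 w) y))
      - dotv (S (w y)) (K (x - y) *m (Jac S (w x) *m (derive1 w) x))) =
    quadrant_form K (S \o w) (linearized S w (derive1 w)) - quadrant_form K (linearized S w (derive1 w)) (S \o w).
  rewrite /quadrant_form /intQ -RintegralB//; last 3 first.
  - exact: measurable_quadrant.
  - exact: (quadrant_form_integrable K_even K_L1 K_moment bs bs').
  - exact: (quadrant_form_integrable K_even K_L1 K_moment bs' bs).
  apply: eq_Rintegral => p _; congr (_ - _); exact: dotv_kernel_sym.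
by rewrite opprD addrA.
Qed.

Lemma derive1_grad_v (R : realType) (d : nat) (E : 'cV[R]_d * 'cV[R]_d -> R)
    (u : R -> 'cV[R]_d) (x : R) (i : 'I_d) :
  Ck 2 E -> derivable u x (1 : R) -> derivable (derive1 u) x (1 : R) ->
  derive1 (fun z => grad_v E (jet u z)) x i 0 =
  'd (momentum E i) (jet u x) (jet (derive1 u) x).
Proof.
move=> E_C2 /derivable1_diffP du /derivable1_diffP du'.
have dj : differentiable (jet u) x by exact: differentiable_pair.
have jE : 'd (jet u) x (1 : R) = jet (derive1 u) x.
  by rewrite (diff_pair du du') /jet !derive1E (deriveE _ du) (deriveE _ du').
have dm j : differentiable (momentum E j) (jet u x) by exact: momentum_diff.
have dmj j : differentiable (momentum E j \o jet u) x by exact: differentiable_comp.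
have gE j : (fun z => grad_v E (jet u z) j 0) = momentum E j \o jet u.
  by apply/funext => z; rewrite grad_vE.
have dg : derivable (fun z => grad_v E (jet u z)) x (1 : R).
  apply/derivable_mxP => j k; rewrite (ord1 k) gE.
  exact: (diff_derivable (dmj j)).
rewrite derive1E (derive_mx dg) mxE gE (deriveE _ (dmj i)).
by rewrite (diff_comp dj (dm i)) /= jE.
Qed.

Theorem lemma3p3 (R : realType) (d : nat)
    (K : R -> 'M[R]_d) (S : 'cV[R]_d -> 'cV[R]_d)
    (E : 'cV[R]_d * 'cV[R]_d -> R)
    (K_even : forall r, K (- r) = K r)
    (K_sym : forall r, (K r)^T = K r)
    (K_L1 : kernel_L1 K)
    (K_moment : kernel_moment K)
    (S_C2 : Ck 2 S)
    (E_C2 : Ck 2 E)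
    (u : C1b R d)
    (u_CRb : Ckb (regularity E) u)
    (u_sol : solution K S E u) :
  differentiable (fun w : C1b R d => Ham K S E w) u /\
  forall v : C1b R d,
    - 'd (fun w : C1b R d => Ham K S E w) u v = omega K S E u (derive1 u) v.
Proof.
have [dj jE] := jet0_diff u.
have [dN NE] := nonlocal_diff K_even K_sym K_L1 K_moment S_C2 u.
have dl : differentiable (local_energy E) (jet u 0) by exact: local_energy_differentiable.
have dlj : differentiable (local_energy E \o (fun w : C1b R d => jet w 0)) u.
  exact: differentiable_comp.
have HE : (fun w : C1b R d => Ham K S E w) =
    - (local_energy E \o (fun w : C1b R d => jet w 0)) + (fun w : C1b R d => nonlocal K S w).
  by apply/funext => w; rewrite (HamE E w K_even K_sym K_L1 K_moment S_C2).
have dNl := differentiableN dlj.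
rewrite HE; split; first exact: differentiableD.
move=> v.
have -> : 'd (- (local_energy E \o (fun w : C1b R d => jet w 0)) +
      (fun w : C1b R d => nonlocal K S w)) u v =
    - 'd (local_energy E) (jet u 0) (jet v 0) + nonlocal_der K S u (linearized S u v).
  rewrite (diffD dNl dN) /= NE (diffN dlj); congr (_ + _).
  by rewrite -[LHS]/(- 'd (local_energy E \o (fun w : C1b R d => jet w 0)) u v) (diff_comp dj dl) /= jE.
rewrite diff_local_energy// opprD opprK.
(* the Euler-Lagrange equation at x = 0, paired with v 0 *)
have EL : dotv (grad_u E (jet u 0)) (v 0) =
    dotv (derive1 (fun z => grad_v E (jet u z)) 0) (v 0)
    - boundary_form K (linearized S u v) (S \o u).
  have := congr1 (fun a => dotv a (v 0)) (u_sol 0).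
  rewrite !dotvDl dotvNl [dotv 0 _]big1; last by move=> i _; rewrite mxE mul0r.
  rewrite [dotv (_ *m _) _]dotvC dotv_trmx -[dotv (Jac _ _ *m _) _]/(boundary_form K (linearized S u v) (S \o u)).
  move: (dotv _ _) (dotv _ _) (boundary_form _ _ _) => x y z; lra.
rewrite EL /nonlocal_der.
set x1 := dotv _ _; set x2 := \sum_(i < d) _; set c := boundary_form _ _ _.
set p1 := quadrant_form _ _ _; set p2 := quadrant_form _ _ _.
have -> : x1 - c - x2 - (- c + p1 - p2) = x1 - x2 + (p2 - p1) by ring.
rewrite /omega; case: ifP => [reg|/negbT reg].
  (* no momentum: only the nonlocal two-form is left *)
  have E0 q : grad_v E q = 0.
    by move: reg; rewrite /regularity; case: asboolP => // + _; apply.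
  have m0 i : momentum E i = cst 0.
    by apply/funext => q; rewrite -grad_vE// E0 mxE.
  rewrite omega_nE//; [|exact: C1b_cbnd|exact: C1b_cbnd1|exact: C1b_cbnd].
  have -> : x1 = 0.
    rewrite /x1 (_ : (fun z => _) = cst 0); last by apply/funext => z; rewrite E0.
    by rewrite derive1_cst /dotv big1// => i _; rewrite mxE mul0r.
  have -> : x2 = 0.
    by rewrite /x2 big1// => i _; rewrite m0 diff_cst mulr0.
  by rewrite subr0 add0r.
have u2 : Ckb 2 u.
  by move: reg u_CRb; rewrite /regularity; case: asboolP.
have u'1 := Ckb2_derive1 u2.
have bu := C1b_cbnd u; have bv := C1b_cbnd v; have bu' := Ckb_cbnd u'1.
have du := @C1b_derivable _ _ u 0; have dv := @C1b_derivable _ _ v 0.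
have du' := @Ckb_derivable _ _ _ _ 0 u'1.
rewrite /dlambda (DlambdaE K_even K_L1 K_moment S_C2 E_C2 bu bu' bv du dv).
rewrite (DlambdaE K_even K_L1 K_moment S_C2 E_C2 bu bv bu' du du').
have -> : (fun x => hess S (u x) (derive1 u x) (v x)) =
    (fun x => hess S (u x) (v x) (derive1 u x)).
  by apply/funext => x; rewrite (hess_sym S_C2).
have -> : x1 = \sum_(i < d) 'd (momentum E i) (jet u 0) (jet (derive1 u) 0) * v 0 i 0.
  by apply: eq_bigr => i _; rewrite (derive1_grad_v i E_C2 du du').
have -> : x2 = \sum_(i < d) 'd (momentum E i) (jet u 0) (jet v 0) * (derive1 u 0) i 0.
  by apply: eq_bigr => i _; rewrite mulrC.
rewrite /p1 /p2.
move: (\sum_(i < d) _) (\sum_(i < d) _) (quadrant_form K _ _) (quadrant_form K _ _) (quadrant_form K _ _).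
move=> a b c1 c2 c3; ring.
Qed.
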